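(* Consider a latent tree model over a semi-labeled tree $T=(V,E)$ with regular nodes $[n]$, and suppose that the correlations $\Sigma=[\rho_{ij}]$ in the underlying tree model admit the path-product formula $$\rho_{ij}=\prod_{uv\in\overline{ij}}\rho_{uv}\qquad\text{for all } i,j\in[n],$$ where $\rho_{uv}$ are the edge correlations, $0<|\rho_{uv}|<1$ for every $uv\in E$, and $\overline{ij}$ is the path from $i$ to $j$ in $T$. Then the algorithm TREE described in the context, applied to the distance oracle defined by $d(i,j)=-\log|\rho_{ij}|$ for all $i\ne j$, recovers the underlying tree $T$, i.e. returns its edge set (up to the naming of the latent nodes).
   Context: Trees. A semi-labeled tree is a finite tree $T=(V,E)$ with a set $W\subseteq V$ of regular (labeled) nodes, here $W=[n]=\{1,\dots,n\}$, such that every vertex of degree $\le 2$ lies in $W$; vertices in $V\setminus W$ are called latent. $\Delta=\max_{v\in V}\deg(v)$. Latent tree model. $Y=(Y_v)_{v\in V}$ is a random vector with values in $\prod_v\mathcal Y_v$ whose density factorizes as $f_Y(y)=\prod_{uv\in E}\psi_{uv}(y_u,y_v)$ with nonnegative potentials $\psi_{uv}$; the latent tree model is the induced model for the subvector $X=(X_1,\dots,X_n)$ of $Y$ indexed by the regular nodes (latent coordinates are marginalized out). $\rho_{uv}$ denotes the correlation of $Y_u$ and $Y_v$. In the algorithm, $d(u,v)$ is accessed for pairs of regular nodes through the oracle. Bags. A bag is a set $B\subseteq V$ with a distinguished representative $\rho(B)\in B$; all elements of $B$ other than possibly $\rho(B)$ are regular. When $\rho(B)$ is latent, the distances $d(v,\rho(B))$,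 $v\in B$, have been computed, so it acts as a regular node. The tree induced by $B$ is the smallest subtree of $T$ containing $B$. A skeleton is a set of edges. BASIC$(B,\alpha)$, $\alpha\in B\setminus\{\rho\}$, $\rho=\rho(B)$: query $d(v,\alpha)$ for all $v\in B$; put $D(v)=d(v,\alpha)-d(v,\rho)$; partition $B$ into bags $B_1,\dots,B_k$ according to the distinct values of $D$, ordered by that value. For each $i$ let $u_i\in\arg\min_{v\in B_i}d(v,\alpha)$. If $d(\rho,u_i)+d(u_i,\alpha)=d(\rho,\alpha)$, set $\rho(B_i)=u_i$. Otherwise introduce the latent node $w_i$ connecting the path from $\alpha$ to $\rho$ with $B_i$, add $w_i$ to $B_i$, set $\rho(B_i)=w_i$, and record $d(v,w_i)=\frac12\left(d(v,\alpha)+d(v,\rho)-d(\alpha,\rho)\right)$ for $v\in B_i$. Return $B_1,\dots,B_k$ and the skeleton $\{(\rho(B_1),\rho(B_2)),\dots,(\rho(B_{k-1}),\rho(B_k))\}$. EXPLODE$(B)$: while $|B|>1$, take $u\in B$, $u\ne\rho(B)$; set $B^*=\{v\in B\setminus\{\rho(B)\}: d(u,v)<d(u,\rho(B))+d(v,\rho(B))\}\cup\{\rho(B)\}$ with $\rho(B^* )=\rho(B)$; output $B^*$; replace $B$ by $\{\rho(B)\}\cup(B\setminus B^* )$. BIGSPLIT$(B)$: repeat the following pass until $M\le|B|/\sqrt\Delta$. Pass: sample $u_1,\dots,u_\kappa$ uniformly at random without replacement from $B\setminus\{\rho(B)\}$; set $\mathcal B=\{B\}$, $S=\emptyset$; for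 $i=1,\dots,\kappa$, find the bag $B^*\in\mathcal B$ containing $u_i$ and, if $u_i\ne\rho(B^* )$, apply BASIC$(B^*,u_i)$, replace $B^*$ in $\mathcal B$ by the bags returned, and add the returned skeleton to $S$; then let $\mathcal C$ be the collection of all bags output by EXPLODE applied to the bags of $\mathcal B$, and let $M$ be the maximal size of a bag in $\mathcal C$ ($0$ if there are none). Output $S$ and $\mathcal C$ from the last pass. (Passes use independent randomness.) TREE (with $\kappa=\Delta$): pick $u\in W$, set $\rho(W)=u$; let $Q$ be a queue containing only the bag $W$; $S=\emptyset$. While $Q$ is nonempty: remove the front bag $B$. If $|B|\le\kappa$, query all $\binom{|B|}{2}$ distances in $B$, find the full set of edges of the tree induced by $B$ and add it to $S$. Otherwise apply BIGSPLIT$(B)$, add its skeleton to $S$ and its output bags to the rear of $Q$. Return $S$. *)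

(* Defs.v *)
From Stdlib Require List.
From HB Require Import structures.
From mathcomp Require Import all_boot all_order all_algebra.
From mathcomp Require Import all_classical all_reals all_analysis.

Set Implicit Arguments.
Unset Strict Implicit.
Unset Printing Implicit Defensive.

Import Order.TTheory GRing.Theory Num.Theory.
Import numFieldNormedType.Exports.

Local Open Scope ring_scope.

Section Trees.
Variables (V : finType) (e : rel V).

Definition degree (v : V) : nat := #|[set u | e v u]|.

Definition max_degree : nat := (\max_(v : V) degree v)%N.

Definition is_tree : Prop :=
  [/\ (0 < #|V|)%N, symmetric e, irreflexive e, (forall u v, connect e u v)
    & forall c : seq V, ucycle e c -> (size c <= 2)%N].

Definition simple_path (u v : V) (p : seq V) : bool :=
  [&& path e u p, last u p == v & uniq (u :: p)].

(* The consecutive pairs of the walk u :: p. *)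
Definition path_edges (u : V) (p : seq V) : seq (V * V) := zip (u :: p) p.

(* lab i is the vertex that carries the label i; the vertices outside the image
   of lab are the latent ones. *)
Definition semi_labeled_tree (n : nat) (lab : 'I_n -> V) : Prop :=
  [/\ is_tree, injective lab
    & forall v, (degree v <= 2)%N -> exists i, lab i = v].
End Trees.

Section LatentTreeModel.
Context d (Omega : measurableType d) (R : realType) (P : probability Omega R).

Definition correlation (X Y : {RV P >-> R}) : R :=
  fine (covariance P X Y) /
  (Num.sqrt (fine ('V_P[X])%E) * Num.sqrt (fine ('V_P[Y])%E)).

Variables (V : finType) (e : rel V) (Y : V -> {RV P >-> R}).

(* Configurations (y_v)_(v in V), as tuples so as to use the library's product
   sigma-algebra. *)
Definition config : Type := #|V|.-tuple R.

Definition coord (y : config) (v : V) : R := tnth y (enum_rank v).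

Definition joint (w : Omega) : config := [tuple Y (enum_val i) w | i < #|V|].

(* Each unordered edge uv contributes exactly one factor. *)
Definition potential_product (psi : V -> V -> R -> R -> R) (y : config) : R :=
  \prod_(uv : V * V | e uv.1 uv.2 && (enum_rank uv.1 < enum_rank uv.2)%N)
    psi uv.1 uv.2 (coord y uv.1) (coord y uv.2).

(* The density of (Y_v)_v is taken with respect to a product mu of sigma-finite
   base measures nu v on the line; nu v may be concentrated on a proper subset
   (a discrete one, say), which plays the role of the state space of Y_v. The
   rectangle rule determines mu. The moment conditions say that the
   correlations are defined. *)
Definition latent_tree_model : Prop :=
  (exists (nu : V -> {measure set (measurableTypeR R) -> \bar R})
          (mu : {measure set (#|V|.-tuple (measurableTypeR R)) -> \bar R})
          (psi : V -> V -> R -> R -> R),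
    [/\ (forall v, sigma_finite [set: R] (nu v)),
        (forall A : V -> set R, (forall v, measurable (A v)) ->
           mu [set y | forall v, A v (coord y v)]%classic
             = (\prod_(v : V) nu v (A v))%E),
        (forall u v s t, 0 <= psi u v s t),
        (forall u v, measurable_fun [set: R * R] (fun z => psi u v z.1 z.2))
      & forall A : set (#|V|.-tuple (measurableTypeR R)), measurable A ->
          P (joint @^-1` A)%classic
            = (\int[mu]_(y in A) (potential_product psi y)%:E)%E])
  /\ forall v, (Y v : Omega -> R) \in Lfun P 2%:E /\ (0 < 'V_P[Y v])%E.
End LatentTreeModel.

(* Node names used by the algorithm: inl i is the regular node i, inr k is the
   k-th latent node it has introduced. *)
Notation node n := ('I_n + nat)%type.

(* S, read as a set of unordered edges, is the image of the edge set of (V, e)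
   under the naming phi. *)
Definition edges_named (n : nat) (V : finType) (e : rel V) (phi : V -> node n)
    (S : seq (node n * node n)) : Prop :=
  (forall u v, e u v = ((phi u, phi v) \in S) || ((phi v, phi u) \in S)) /\
  (forall x y, (x, y) \in S -> exists u v, x = phi u /\ y = phi v).

Definition recovers (n : nat) (V : finType) (e : rel V) (lab : 'I_n -> V)
    (S : seq (node n * node n)) : Prop :=
  exists phi : V -> node n,
    [/\ injective phi, (forall i, phi (lab i) = inl i) & edges_named e phi S].

Section Bags.
Variables (n : nat) (R : realType).
Implicit Type d : 'I_n -> 'I_n -> R.

(* The bag {brep} u {inl i | i in bothers}. The field bdrep holds the recorded
   distances d(i, brep); it is only read when brep is latent. *)
Record bag := Bag {
  brep : node n;
  bothers : {set 'I_n};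
  bdrep : 'I_n -> R }.

Definition belts (B : bag) : seq (node n) :=
  brep B :: [seq inl i | i <- enum (bothers B)].

Definition bsize (B : bag) : nat := #|bothers B|.+1.

(* Distance of two elements of B; the only latent element of B is brep B. *)
Definition bdist d (B : bag) (x y : node n) : R :=
  match x, y with
  | inl i, inl j => d i j
  | inl i, inr _ => bdrep B i
  | inr _, inl j => bdrep B j
  | inr _, inr _ => 0
  end.

(* F is the edge list of a semi-labeled tree whose labeled vertices are the
   elements of B, whose other vertices are named inr k, ..., inr k'.-1, and which
   has positive edge lengths that realize the distances D on B. *)
Definition tree_on (k : nat) (B : bag) (D : node n -> node n -> R)
    (F : seq (node n * node n)) (k' : nat) : Prop :=
  exists (V : finType) (e : rel V) (phi : V -> node n) (len : V -> V -> R),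
    [/\ is_tree e, injective phi & edges_named e phi F] /\
    [/\ (k <= k')%N,
        (forall x, x \in belts B -> exists v, phi v = x),
        (forall v, phi v \notin belts B ->
           exists j, phi v = inr j /\ (k <= j < k')%N)
      & (forall v, (degree e v <= 2)%N -> phi v \in belts B)] /\
    [/\ (forall u v, len u v = len v u),
        (forall u v, e u v -> 0 < len u v)
      & (forall u v p, phi u \in belts B -> phi v \in belts B ->
           simple_path e u v p ->
           D (phi u) (phi v) = \sum_(ab <- path_edges u p) len ab.1 ab.2)].

(* A resolution of the choices that the pseudocode leaves open: the root, the
   minimizer in BASIC, the element taken in EXPLODE, and the procedure that
   computes the tree of a small bag from its distance matrix. That procedure
   sees nothing of the underlying tree; it receives the first unused latent
   name and returns the edges with the next unused latent name. *)
Record choices := Choices {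
  ch_root : 'I_n;
  ch_argmin : seq (node n) -> (node n -> R) -> node n;
  ch_take : bag -> 'I_n;
  ch_solve : nat -> bag -> (node n -> node n -> R) ->
             seq (node n * node n) * nat;
  ch_argminP : forall s f, s != [::] ->
    ch_argmin s f \in s /\ forall x, x \in s -> f (ch_argmin s f) <= f x;
  ch_takeP : forall B, bothers B != finset.set0 -> ch_take B \in bothers B;
  ch_solveP : forall k B D F k', tree_on k B D F k' ->
    tree_on k B D (ch_solve k B D).1 (ch_solve k B D).2 }.
End Bags.

Section Algorithm.
Variables (n : nat) (R : realType) (d : 'I_n -> 'I_n -> R).
(* Delta is the maximal degree, also used as the sample size kappa. *)
Variables (c : choices n R) (Delta : nat).

(* The bag of BASIC(B, a) with D-value t; j is the name of its latent node if
   one is introduced. The class of brep B never introduces one: brep B is its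
   unique minimizer. *)
Definition basic_bag (B : bag n R) (a : 'I_n) (j : nat) (t : R) : bag n R :=
  let rho := brep B in
  let alpha := inl a : node n in
  let dist := bdist d B in
  let Bi := [seq v <- belts B | dist v alpha - dist v rho == t] in
  let u := ch_argmin c Bi (fun v => dist v alpha) in
  if dist rho u + dist u alpha == dist rho alpha then
    Bag u [set i | ((inl i : node n) \in Bi) && ((inl i : node n) != u)]
        (bdrep B)
  else
    Bag (inr j) [set i | (inl i : node n) \in Bi]
        (fun i => (dist (inl i) alpha + dist (inl i) rho - dist alpha rho) / 2).

(* In what follows k is the first unused latent name, and a returned number is
   its new value. *)
Definition basic (k : nat) (B : bag n R) (a : 'I_n) :
    seq (bag n R) * seq (node n * node n) * nat :=
  let dist := bdist d B in
  let vals := sort <=%R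
    (undup [seq dist v (inl a) - dist v (brep B) | v <- belts B]) in
  let bags := [seq basic_bag B a (k + i)%N (nth 0 vals i)
              | i <- iota 0 (size vals)] in
  let reps := [seq brep b | b <- bags] in
  (bags, zip reps (behead reps), (k + size vals)%N).

(* Fuel #|bothers B| suffices: each iteration removes at least u. *)
Fixpoint explode_rec (fuel : nat) (B : bag n R) : seq (bag n R) :=
  if fuel isn't fuel'.+1 then [::] else
  if bothers B == finset.set0 then [::] else
  let u := inl (ch_take c B) : node n in
  let rho := brep B in
  let dist := bdist d B in
  let Bstar := [set v in bothers B |
                 dist u (inl v) < dist u rho + dist (inl v) rho] in
  Bag rho Bstar (bdrep B)
    :: explode_rec fuel' (Bag rho (bothers B :\: Bstar) (bdrep B)).

Definition explode (B : bag n R) : seq (bag n R) :=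
  explode_rec #|bothers B| B.

(* One iteration of the inner loop of BIGSPLIT, for the sampled node u. *)
Fixpoint refine (k : nat) (Bs : seq (bag n R)) (u : 'I_n) :
    seq (bag n R) * seq (node n * node n) * nat :=
  if Bs isn't B :: Bs' then ([::], [::], k) else
  if brep B == inl u then (Bs, [::], k) else
  if u \in bothers B then
    let: (new, E, k') := basic k B u in (new ++ Bs', E, k')
  else
    let: (Bs'', E, k') := refine k Bs' u in (B :: Bs'', E, k').

Fixpoint refine_all (k : nat) (Bs : seq (bag n R))
    (E : seq (node n * node n)) (us : seq 'I_n) :
    seq (bag n R) * seq (node n * node n) * nat :=
  if us isn't u :: us' then (Bs, E, k) else
  let: (Bs', E', k') := refine k Bs u in refine_all k' Bs' (E ++ E') us'.

(* One pass of BIGSPLIT on B with sample us. *)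
Definition split_pass (k : nat) (B : bag n R) (us : seq 'I_n) :
    seq (bag n R) * seq (node n * node n) * nat :=
  let: (Bs, E, k') := refine_all k [:: B] [::] us in
  (flatten [seq explode b | b <- Bs], E, k').

Definition accepted (B : bag n R) (C : seq (bag n R)) : bool :=
  ((\max_(b <- C) bsize b)%N%:R : R) <= (bsize B)%:R / Num.sqrt Delta%:R.

Record state := State {
  queue : seq (bag n R);
  skel : seq (node n * node n);
  fresh : nat }.

Definition tree_init : state :=
  State [:: Bag (inl (ch_root c)) [set~ ch_root c] (fun=> 0)] [::] 0.

(* Ordered samples without replacement from B \ {brep B}. *)
Definition samples (B : bag n R) : seq (Delta.-tuple 'I_n) :=
  enum [pred us : Delta.-tuple 'I_n |
         uniq us && all (fun i => i \in bothers B) us].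

Definition small_step (B : bag n R) (Q : seq (bag n R)) (st : state) : state :=
  let: (F, k') := ch_solve c (fresh st) B (bdist d B) in
  State Q (skel st ++ F) k'.

(* A rejected pass leaves the state unchanged, so that B is tried again. *)
Definition big_step (B : bag n R) (Q : seq (bag n R)) (st : state)
    (us : seq 'I_n) : state :=
  let: (C, E, k') := split_pass (fresh st) B us in
  if accepted B C then State (Q ++ C) (skel st ++ E) k' else st.

(* The equally likely states after the next step of TREE: the treatment of a
   small bag, or one pass of BIGSPLIT. *)
Definition successors (st : state) : seq state :=
  if queue st isn't B :: Q then [::] else
  if (bsize B <= Delta)%N then [:: small_step B Q st]
  else [seq big_step B Q st us | us : Delta.-tuple 'I_n <- samples B].

Inductive reachable : state -> Prop :=
| reachable_init : reachable tree_init
| reachable_step st st' :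
    reachable st -> List.In st' (successors st) -> reachable st'.

Definition tree_returns (E : seq (node n * node n)) : Prop :=
  exists st, [/\ reachable st, queue st = [::] & skel st = E].

(* Probability that TREE, started in st, halts within N steps. *)
Fixpoint halt_prob (N : nat) (st : state) : R :=
  if queue st is [::] then 1 else
  if N isn't N'.+1 then 0 else
  (\sum_(st' <- successors st) halt_prob N' st') / (size (successors st))%:R.
End Algorithm.

Definition log_oracle (n : nat) (R : realType) (r : 'I_n -> 'I_n -> R)
    (i j : 'I_n) : R :=
  if i == j then 0 else - ln `|r i j|.

(* Main.v *)
Require Import Defs.
From mathcomp Require Import all_boot all_order all_algebra.
From mathcomp Require Import all_classical all_reals all_analysis.
From mathcomp Require Import lra.

(** The numbers [- ln `|r u v|], for [r] the edge correlations, are positive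
    edge lengths, and the path-product formula says that the oracle returns
    the path metric of the tree on its labels. What remains is a statement about
    tree metrics.

    Every bag formed by the algorithm consists of a vertex [w] and of the labels
    in a union [U] of components of the tree without [w]. BASIC applied to an
    element [a] computes the projections of the elements of the bag to the path
    from [w] to [a]: the value [d(v,a) - d(v,w)] determines the projection of
    [v], the test of BASIC says whether the projection is itself an element, and
    every vertex of the path is the projection of an element because a latent
    vertex has a third branch. So BASIC records exactly the edges of the path and
    leaves one such bag at each of its vertices. EXPLODE separates the components
    of a bag. A small bag is solved correctly because a semi-labeled tree is
    determined by the distances between its labels ([tree_metric_unique]): its
    vertices are medians of labels, and the distances from a median to the
    labels are determined by those between labels. All these steps preserve one
    invariant, [resolution]: the vertices outside the remaining regions have
    final names, the skeleton is the set of edges between them, and the remaining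
    bags cover the rest. When no bag remains, the skeleton is the tree.

    Termination. Seen from the top vertex of the bag being split, the bags that
    a pass returns are sets of descendants, so they belong to a laminar family,
    and they contain no sampled label. A counting argument gives at most [Delta]
    labels that meet all the members that are too large
    ([ex_accepted_sample]); hence some sample is accepted. An accepted pass
    lowers the number of labels in the bags, and a rejected one changes nothing.
    The limits of the halting probabilities exist by monotonicity and satisfy a
    mean value equation, which forces them to be 1 ([halt_lim1]). *)

Set Implicit Arguments.
Unset Strict Implicit.
Unset Printing Implicit Defensive.

Import Order.TTheory GRing.Theory Num.Theory.
Import numFieldNormedType.Exports.

Local Open Scope ring_scope.

(** * Simple paths and betweenness in a tree *)

Section TreePaths.
Variables (V : finType) (e : rel V).
Hypothesis treeT : is_tree e.

Let e_sym : symmetric e. Proof. by case: treeT. Qed.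
Let e_irr : irreflexive e. Proof. by case: treeT. Qed.

Lemma ex_simple_path u v : exists p, simple_path e u v p.
Proof.
have [_ _ _ conn _] := treeT.
have /connectP[p ep ->] := conn u v.
case/shortenP: ep => q eq uq _; exists q.
by rewrite /simple_path eq eqxx.
Qed.

(** If two simple paths from [u] leave [u] by different neighbours, their tails
    connect these neighbours without using [u], and closing this connection
    through [u] gives a cycle of length at least three. *)
Lemma simple_path_inj u v p q :
  simple_path e u v p -> simple_path e u v q -> p = q.
Proof.
have loop w b s : simple_path e w w (b :: s) -> False.
  by case/and3P=> _ /eqP /= <-; rewrite mem_last.
elim: p u q => [|a p IHp] u [|b q] //.
- by case/and3P=> _ /eqP /= <- _ /loop.
- by move=> + /and3P[_ /eqP /= uv _]; rewrite -uv => /loop.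
case: (eqVneq a b) => [<-|neq_ab].
  case/and3P=> /= /andP[_ ep] lp /andP[_ up].
  case/and3P=> /= /andP[_ eq] lq /andP[_ uq].
  by congr (_ :: _); apply: (IHp a); rewrite /simple_path /= ?ep ?eq ?lp ?lq ?up ?uq.
move=> sp sq; exfalso.
pose e' := [rel x y | [&& e x y, x != u & y != u]].
have e'_sym : connect_sym e'.
  apply: sym_connect_sym => y z; rewrite /e' /= e_sym; congr andb.
  by rewrite andbC.
have reach x s : simple_path e u v (x :: s) -> connect e' x v.
  case/and3P=> /= /andP[_ es] /eqP <- /andP[us _].
  apply/connectP; exists s => //.
  have sub : {in x :: s &, subrel e e'}.
    by move=> y z ys zs /= ->; rewrite (memPn us) // (memPn us).
  by apply: (sub_in_path sub) es; apply/allP.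
have: connect e' a b.
  by apply: connect_trans (reach _ _ sp) _; rewrite e'_sym; apply: reach sq.
case/connectP=> r0 er0 lr0; move: lr0.
case/shortenP: er0 => r er ur _ lr {r0}.
have [_ _ _ _ acyc] := treeT.
case/and3P: sp => /= /andP[eua _] _ /andP[uap _].
case/and3P: sq => /= /andP[eub _] _ _.
suff: ucycle e (u :: a :: r).
  by move/acyc; case: (r) lr => //= abE; rewrite abE eqxx in neq_ab.
have ner : all (fun y => y != u) r.
  elim: (r) (a) er => //= y s IHs x /andP[/and3P[_ _ ->] /IHs ->] //.
apply/andP; split; last first.
  rewrite cons_uniq ur andbT inE negb_or; apply/andP; split.
    by move: uap; rewrite inE negb_or => /andP[].
  by apply/negP=> /(allP ner); rewrite eqxx.
rewrite /= eua rcons_path -lr e_sym eub andbT /=.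
by apply: sub_path er => x y /and3P[].
Qed.

Definition spath u v : seq V := xchoose (ex_simple_path u v).

Lemma spathP u v : simple_path e u v (spath u v).
Proof. exact: xchooseP (ex_simple_path u v). Qed.

Lemma spathE u v p : simple_path e u v p -> spath u v = p.
Proof. exact: simple_path_inj (spathP u v). Qed.

Lemma path_spath u v : path e u (spath u v).
Proof. by case/and3P: (spathP u v). Qed.

Lemma last_spath u v : last u (spath u v) = v.
Proof. by case/and3P: (spathP u v) => _ /eqP. Qed.

Lemma uniq_spath u v : uniq (u :: spath u v).
Proof. by case/and3P: (spathP u v). Qed.

Lemma spathxx u : spath u u = [::].
Proof. by apply: spathE; rewrite /simple_path /= eqxx. Qed.

Lemma spath_edge u v : e u v -> spath u v = [:: v].
Proof.
move=> euv; apply: spathE; rewrite /simple_path /= euv eqxx inE andbT /=.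
by rewrite andbT; apply: contraTneq euv => ->; rewrite e_irr.
Qed.

Lemma spath_rev u v : spath v u = rev (belast u (spath u v)).
Proof.
apply: spathE; apply/and3P; split.
- rewrite -[X in path _ X](last_spath u) rev_path.
  by rewrite (eq_path (e' := e)) ?path_spath // => x y; rewrite e_sym.
- case E: (spath u v) (last_spath u v) => [|a p] /= lv; first by rewrite -lv.
  by rewrite rev_cons last_rcons.
- rewrite -[X in X :: _](last_spath u) -rev_rcons -lastI rev_uniq.
  exact: uniq_spath.
Qed.

(** The arguments come in the order of the path; endpoints are included. *)
Definition btw u w v := w \in u :: spath u v.

Lemma btw_l u v : btw u u v. Proof. exact: mem_head. Qed.

Lemma btw_r u v : btw u v v.
Proof. by rewrite /btw -[X in X \in _](last_spath u v) mem_last. Qed.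

Lemma btw_id u w : btw u w u = (w == u).
Proof. by rewrite /btw spathxx inE. Qed.

Lemma btwC u w v : btw u w v = btw v w u.
Proof.
rewrite /btw (spath_rev u v) -[X in X :: rev _](last_spath u v) -rev_rcons.
by rewrite mem_rev -lastI.
Qed.

Lemma btw_edge u w v : e u v -> btw u w v = (w == u) || (w == v).
Proof. by move=> euv; rewrite /btw (spath_edge euv) !inE. Qed.

Lemma spath_btw u w v : btw u w v -> spath u v = spath u w ++ spath w v.
Proof.
rewrite /btw => wp; move: wp (spathP u v); move: (spath u v) => s.
case/splitPl=> p q lp.
rewrite /simple_path last_cat cat_path lp -cat_cons cat_uniq.
case/and3P=> /andP[ep eq] lq /and3P[up hpq uq].
congr (_ ++ _); symmetry; apply: spathE; rewrite /simple_path.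
  by rewrite ep lp eqxx up.
rewrite eq lq /= uq andbT.
by apply: contra hpq => wq; apply/hasP; exists w; rewrite // -lp mem_last.
Qed.

(** The walk from [u] to [v] through [l] shortens to the simple path, so it
    visits [w]. This hyperbolicity of trees carries most of the geometry. *)
Lemma btw_split u w v l : btw u w v -> btw u w l \/ btw l w v.
Proof.
move=> uwv; apply/orP.
pose p := spath u l ++ spath l v.
have ep : path e u p by rewrite cat_path last_spath !path_spath.
have lp : last u p = v by rewrite last_cat !last_spath.
case/shortenP: ep lp => q eq uq sub lq.
have spq : spath u v = q by apply: spathE; rewrite /simple_path eq lq eqxx.
move: uwv; rewrite /btw spq inE => /orP[/eqP->|/sub]; first by rewrite mem_head.
by rewrite mem_cat !inE => /orP[] ->; rewrite ?orbT.
Qed.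

Lemma spath_edge_cons u x v : e u x -> ~~ btw u x v -> spath x v = u :: spath u v.
Proof.
move=> eux nuxv; apply: spathE; apply/and3P; split.
- by rewrite /= e_sym eux path_spath.
- by rewrite /= last_spath.
- by rewrite cons_uniq uniq_spath andbT.
Qed.

Lemma edge_btw u x v : e u x -> ~~ btw u x v -> btw x u v.
Proof.
move=> eux /(spath_edge_cons eux) sE.
by rewrite /btw sE !inE eqxx orbT.
Qed.

Lemma first_step u v : u != v -> exists2 x, e u x & btw u x v.
Proof.
move=> neq; move: (path_spath u v) (last_spath u v); rewrite /btw.
case: (spath u v) => [_ /= uv|x p /= /andP[eux _] _]; first by rewrite uv eqxx in neq.
by exists x => //; rewrite !inE eqxx /= ?orbT.
Qed.

Lemma first_step_uniq u x y v :
  e u x -> e u y -> btw u x v -> btw u y v -> x = y.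
Proof.
move=> eux euy /spath_btw sx /spath_btw sy; move: sx; rewrite sy.
by rewrite (spath_edge eux) (spath_edge euy) => -[].
Qed.

(** The first vertex of the path from [w] to [u] that lies on the path from
    [u] to [v]: the part of the path before it avoids the path from [u] to [v],
    so that continuing to [v] gives a simple path. *)
Lemma median u v w : exists m, [/\ btw u m v, btw u m w & btw v m w].
Proof.
have uin : has (fun x => btw u x v) (w :: spath w u).
  by apply/hasP; exists u; [exact: btw_r | exact: btw_l].
pose s := w :: spath w u; pose i := find (fun x => btw u x v) s.
have ltis : (i < size s)%N by rewrite -has_find.
pose m := nth w s i.
have umv : btw u m v by exact: nth_find.
have ms : m \in s by exact: mem_nth.
exists m; split => //; first by rewrite btwC.
have wmu : btw w m u by [].
rewrite btwC; suff -> : btw w m v by [].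
suff sE : spath w v = spath w m ++ spath m v.
  by rewrite /btw sE -cat_cons mem_cat [m \in _](btw_r w m).
apply: spathE; rewrite /simple_path cat_path last_cat !last_spath !path_spath eqxx.
rewrite -cat_cons cat_uniq uniq_spath !andTb.
have := uniq_spath m v; rewrite cons_uniq => /andP[mmv ->]; rewrite andbT.
apply/hasPn=> x xmv; apply/negP=> xwm.
have uxv : btw u x v.
  by move: xmv; rewrite /btw (spath_btw umv) inE mem_cat => ->; rewrite !orbT.
have sE : s = (w :: spath w m) ++ spath m u by rewrite /s (spath_btw wmu).
have iE : i = size (spath w m).
  have : index m s = i by rewrite index_uniq //; exact: uniq_spath.
  rewrite sE index_cat [m \in _](btw_r w m) => <-.
  by have := index_last (uniq_spath w m); rewrite last_spath.
have : (index x s < i)%N.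
  have lex : (index x (w :: spath w m) <= size (spath w m))%N.
    by rewrite -ltnS -[X in (_ < X)%N]/(size (w :: spath w m)) index_mem.
  rewrite sE index_cat xwm iE ltn_neqAle lex andbT.
  apply: contraNneq mmv => ixE.
  suff mx : m = x by rewrite {1}mx.
  by have := last_nth w w (spath w m); rewrite last_spath -ixE nth_index.
by move/(before_find w); rewrite nth_index ?uxv // sE mem_cat xwm.
Qed.

End TreePaths.

(** * The path metric *)

Section TreeMetric.
Variables (V : finType) (e : rel V) (R : realFieldType) (len : V -> V -> R).
Hypothesis treeT : is_tree e.
Hypothesis len_sym : forall u v, len u v = len v u.
Hypothesis len_gt0 : forall u v, e u v -> 0 < len u v.

Notation spath := (spath treeT).
Notation btw := (btw treeT).

Definition plen u (p : seq V) : R := \sum_(ab <- path_edges u p) len ab.1 ab.2.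

Lemma plen_cons u x p : plen u (x :: p) = len u x + plen x p.
Proof. by rewrite /plen [path_edges _ _]/= big_cons. Qed.

Lemma plen_nil u : plen u [::] = 0.
Proof. by rewrite /plen big_nil. Qed.

Lemma plen_cat u p q : plen u (p ++ q) = plen u p + plen (last u p) q.
Proof.
elim: p u => [|a p IHp] u; first by rewrite plen_nil add0r.
by rewrite cat_cons !plen_cons IHp addrA.
Qed.

Lemma plen_rev u p : plen (last u p) (rev (belast u p)) = plen u p.
Proof.
elim: p u => [|a p IHp] u //=.
rewrite rev_cons -cats1 plen_cat IHp !plen_cons plen_nil addr0 addrC len_sym.
congr (len _ _ + _); case: p {IHp} => [|b p] //=.
by rewrite rev_cons last_rcons.
Qed.

Definition tdist u v : R := plen u (spath u v).

Lemma tdistxx u : tdist u u = 0.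
Proof. by rewrite /tdist spathxx plen_nil. Qed.

Lemma tdistC u v : tdist u v = tdist v u.
Proof. by rewrite /tdist (spath_rev treeT u v) -{2}(last_spath treeT u v) plen_rev. Qed.

Lemma tdist_btw u w v : btw u w v -> tdist u v = tdist u w + tdist w v.
Proof.
by move=> /spath_btw sE; rewrite /tdist sE plen_cat last_spath.
Qed.

Lemma tdist_edge u v : e u v -> tdist u v = len u v.
Proof. by move=> euv; rewrite /tdist spath_edge // plen_cons plen_nil addr0. Qed.

Lemma plen_ge0 u p : path e u p -> 0 <= plen u p.
Proof.
elim: p u => [|a p IHp] u /=; first by rewrite plen_nil.
by case/andP=> eua /IHp ?; rewrite plen_cons addr_ge0 // ltW // len_gt0.
Qed.

Lemma tdist_ge0 u v : 0 <= tdist u v.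
Proof. exact/plen_ge0/path_spath. Qed.

Lemma tdist_gt0 u v : u != v -> 0 < tdist u v.
Proof.
case/(first_step treeT)=> x eux uxv; rewrite (tdist_btw uxv) tdist_edge //.
by rewrite ltr_wpDr ?tdist_ge0 ?len_gt0.
Qed.

Lemma tdist_eq0 u v : tdist u v = 0 -> u = v.
Proof. by move=> d0; apply: contra_eq d0 => /tdist_gt0; rewrite lt0r => /andP[]. Qed.

(** If [m] is the median of the three vertices, then [dist u w + dist w v]
    exceeds [dist u v] by twice [dist m w]. *)
Lemma btwE u w v : btw u w v = (tdist u v == tdist u w + tdist w v).
Proof.
apply/idP/eqP => [/tdist_btw //|dE].
have [m [um vm wm]] := median treeT u v w.
suff -> : w = m by [].
apply: tdist_eq0; move: dE.
rewrite (tdist_btw um) (tdist_btw vm) [tdist w v]tdistC (tdist_btw wm).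
rewrite [tdist m v]tdistC [tdist w m]tdistC; lra.
Qed.

Lemma tdist_triangle u w v : tdist u v <= tdist u w + tdist w v.
Proof.
have [m [um vm wm]] := median treeT u v w.
rewrite (tdist_btw um) (tdist_btw vm) [tdist w v]tdistC (tdist_btw wm).
have := tdist_ge0 m w; rewrite [tdist m v]tdistC; lra.
Qed.

Lemma btw_ltE u w v : btw u w v = ~~ (tdist u v < tdist u w + tdist w v).
Proof. by rewrite btwE eq_le -leNgt tdist_triangle. Qed.

End TreeMetric.

Section Betweenness.
Variables (V : finType) (e : rel V).
Hypothesis treeT : is_tree e.

Notation btw := (btw treeT).

Let e_irr : irreflexive e. Proof. by case: treeT. Qed.
(* Betweenness does not depend on lengths; with unit lengths its order
   properties become linear arithmetic. *)
Let len1 (u v : V) : rat := 1.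
Let len1C u v : len1 u v = len1 v u. Proof. by []. Qed.
Let len1_gt0 u v : e u v -> 0 < len1 u v. Proof. by rewrite /len1. Qed.
Let d := tdist len1 treeT.
Let dC u v : d u v = d v u. Proof. exact: tdistC. Qed.
Let dE u w v : btw u w v = (d u v == d u w + d w v). Proof. exact: btwE. Qed.
Let d_triangle u w v : d u v <= d u w + d w v. Proof. exact: tdist_triangle. Qed.
Let d_ge0 u v : 0 <= d u v. Proof. exact: tdist_ge0. Qed.
Let d_eq0 u v : d u v = 0 -> u = v. Proof. exact: tdist_eq0. Qed.

Lemma btw_anti u v w : btw u v w -> btw v u w -> u = v.
Proof.
rewrite !dE => /eqP + /eqP; rewrite [d v u]dC => d1 d2.
apply: d_eq0; lra.
Qed.

Lemma btw_trans u x y v : btw u x y -> btw u y v -> btw u x v.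
Proof.
rewrite !dE => /eqP d1 /eqP d2; rewrite eq_le d_triangle /=.
have := d_triangle x y v; lra.
Qed.

Lemma btw_trans_r u x y v : btw u x y -> btw u y v -> btw x y v.
Proof.
rewrite !dE => /eqP d1 /eqP d2; rewrite eq_le d_triangle /=.
have := d_triangle u x v; lra.
Qed.

Lemma btw_total u v x y : btw u x v -> btw u y v -> btw u x y \/ btw u y x.
Proof.
move=> uxv uyv; have [?|yxv] := btw_split y uxv; [by left|right].
move: uxv uyv yxv; rewrite !dE => /eqP d1 /eqP d2 /eqP d3.
rewrite eq_le d_triangle /=; have := d_triangle u x v.
have := d_ge0 x y; have := d_triangle u y x; lra.
Qed.

Lemma edge_btwN u x v : e u x -> btw x u v = ~~ btw u x v.
Proof.
move=> eux; apply/idP/idP => [xuv|]; last exact: edge_btw.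
apply/negP => uxv; have := btw_anti xuv uxv => xu.
by rewrite xu e_irr in eux.
Qed.

Variables (X : Type) (lab : X -> V).
Hypothesis deg_lab : forall v, (degree e v <= 2)%N -> exists i, lab i = v.

(** Among the vertices that [v] separates from [u], one that is farthest from
    [u] has all its neighbours on the way back to [u], hence degree at most 1. *)
Lemma label_beyond u v : exists i, btw u v (lab i).
Proof.
pose A := [pred x | btw u v x].
have [x uvx xmax] : exists2 x, btw u v x & forall y, btw u v y -> d u y <= d u x.
  have Av : A v by exact: btw_r.
  by case: (@arg_maxP _ _ _ v A (d u) Av) => x Ax xmax; exists x.
suff: (degree e x <= 1)%N.
  by move=> dx; have [i ix] := deg_lab (leq_trans dx (leqnSn 1)); exists i; rewrite ix.
have back y : e x y -> btw x y u.
  move=> exy; apply/negPn/negP => nxyu.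
  have uxy : btw u x y by rewrite btwC; apply: edge_btw.
  have := xmax _ (btw_trans uvx uxy); rewrite (eqP (etrans (esym (dE _ _ _)) uxy)).
  by rewrite [d x y]tdist_edge // gerDl leNgt len1_gt0.
rewrite /degree leqNgt; apply/negP => /card_gt1P[y [z []]].
rewrite !inE => exy exz /negP; apply; apply/eqP.
exact: first_step_uniq exy exz (back _ exy) (back _ exz).
Qed.

(** At most one neighbour of [x] leads to [a] and at most one to [b]; beyond a
    third neighbour there is a label. *)
Lemma third_label x a b :
  (2 < degree e x)%N -> exists i, btw a x (lab i) /\ btw b x (lab i).
Proof.
move=> dx.
have [y exy [ny1 ny2]] : exists2 y, e x y & ~~ btw x y a /\ ~~ btw x y b.
  pose A c := [set y | e x y & btw x y c].
  have A1 c : (#|A c| <= 1)%N.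
    rewrite leqNgt; apply/negP => /card_gt1P[y [z []]]; rewrite !inE.
    case/andP=> exy xyc /andP[exz xzc] /negP; apply; apply/eqP.
    exact: first_step_uniq exy exz xyc xzc.
  have /subsetPn[y] : ~~ ([set y | e x y] \subset A a :|: A b).
    apply/negP => /subset_leq_card; rewrite leqNgt => /negP; apply.
    apply: leq_ltn_trans dx; apply: leq_trans (leq_card_setU _ _) _.
    by rewrite -[2%N]/(1 + 1)%N leq_add.
  by rewrite !inE => exy; rewrite exy negb_or /= => /andP[]; exists y.
have [i xyi] := label_beyond x y; exists i.
have half c : ~~ btw x y c -> btw c x (lab i).
  move=> /(edge_btw exy); rewrite btwC => cxy.
  have [//|] := btw_split (lab i) cxy.
  rewrite btwC => yxi; have yx := btw_anti yxi xyi.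
  by rewrite yx e_irr in exy.
by split; apply: half.
Qed.

(** Adjacency can be read off betweenness, hence off the distances. *)
Lemma edge_btwP u v :
  reflect (u != v /\ forall z, btw u z v -> z = u \/ z = v) (e u v).
Proof.
apply: (iffP idP) => [euv|[neq_uv noz]].
  split=> [|z]; first by apply: contraTneq euv => ->; rewrite e_irr.
  by rewrite btw_edge // => /orP[/eqP|/eqP]; [left|right].
have [x eux /noz[xu|<- //]] := first_step treeT neq_uv.
by rewrite xu e_irr in eux.
Qed.

(** A latent vertex has three branches, and each contains a label. *)
Lemma median_of_labels v : exists i j k,
  [/\ btw (lab i) v (lab j), btw (lab j) v (lab k) & btw (lab i) v (lab k)].
Proof.
have [/deg_lab[i <-]|dv] := leqP (degree e v) 2.
  by exists i, i, i; split; exact: btw_l.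
have [i _] := third_label v v dv.
have [j [ij _]] := third_label (lab i) (lab i) dv.
have [k [ik jk]] := third_label (lab i) (lab j) dv.
by exists i, j, k.
Qed.

End Betweenness.

Section MetricBetweenness.
Variables (V : finType) (e : rel V) (R : realFieldType) (len : V -> V -> R).
Hypothesis treeT : is_tree e.
Hypothesis len_sym : forall u v, len u v = len v u.
Hypothesis len_gt0 : forall u v, e u v -> 0 < len u v.

Notation spath := (spath treeT).
Notation btw := (btw treeT).

Notation tdist := (tdist len treeT).
Let tdistC u v : tdist u v = tdist v u. Proof. exact: tdistC. Qed.
Let tdist_triangle u w v : tdist u v <= tdist u w + tdist w v.
Proof. exact: tdist_triangle. Qed.

Lemma btw_eq_dist u v x y :
  btw u x v -> btw u y v -> tdist u x = tdist u y -> x = y.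
Proof.
move=> uxv uyv dxy; case: (btw_total uxv uyv) => /(tdist_btw len) d.
  by apply: (tdist_eq0 len_gt0 (treeT := treeT)); lra.
by apply/esym/(tdist_eq0 len_gt0 (treeT := treeT)); lra.
Qed.

(** By hyperbolicity [m] separates [l] from at least two of [i], [j], [k]; the
    gap of such a pair is [2 * tdist m l], and no gap exceeds this value. So
    the distance from a median of labels to a label is a function of the
    distances between labels. *)
Lemma tdist_median i j k m l :
  btw i m j -> btw j m k -> btw i m k ->
  let gap a b := tdist a l + tdist b l - tdist a b in
  2 * tdist m l = Num.max (gap i j) (Num.max (gap j k) (gap i k)).
Proof.
move=> imj jmk imk gap.
have gap_le a b : btw a m b -> gap a b <= 2 * tdist m l.
  move=> /(tdist_btw len); rewrite /gap [tdist m b]tdistC.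
  have := tdist_triangle a m l; have := tdist_triangle b m l; lra.
have gap_eq a b : btw a m b -> btw a m l -> btw b m l -> gap a b = 2 * tdist m l.
  move=> /(tdist_btw len) + /(tdist_btw len) + /(tdist_btw len).
  rewrite /gap [tdist m b]tdistC; lra.
have := gap_le _ _ imj; have := gap_le _ _ jmk; have := gap_le _ _ imk.
have : [\/ gap i j = 2 * tdist m l, gap j k = 2 * tdist m l
          | gap i k = 2 * tdist m l].
  have [iml|lmj] := btw_split l imj.
    have [jml|lmk] := btw_split l jmk; first by constructor 1; apply: gap_eq.
    by constructor 3; apply: gap_eq; rewrite // btwC.
  have [iml|lmk] := btw_split l imk.
    by constructor 1; apply: gap_eq; rewrite // btwC.
  by constructor 2; apply: gap_eq; rewrite // btwC.
rewrite /Num.max; case: ifP; case: ifP => + + []; lra.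
Qed.

End MetricBetweenness.

(** * A tree is determined by the distances between its labels *)

Section TwoTrees.
Variables (R : realFieldType) (X : Type).

Section Match.
Variables (V1 V2 : finType) (e1 : rel V1) (e2 : rel V2).
Variables (len1 : V1 -> V1 -> R) (len2 : V2 -> V2 -> R).
Hypotheses (T1 : is_tree e1) (T2 : is_tree e2).
Hypothesis len1C : forall u v, len1 u v = len1 v u.
Hypothesis len2C : forall u v, len2 u v = len2 v u.
Hypothesis len1_gt0 : forall u v, e1 u v -> 0 < len1 u v.
Hypothesis len2_gt0 : forall u v, e2 u v -> 0 < len2 u v.
Variables (lab1 : X -> V1) (lab2 : X -> V2).
Hypothesis deg1 : forall v, (degree e1 v <= 2)%N -> exists i, lab1 i = v.
Hypothesis deg2 : forall v, (degree e2 v <= 2)%N -> exists i, lab2 i = v.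

Notation d1 := (tdist len1 T1).
Notation d2 := (tdist len2 T2).

Definition same_profile (v1 : V1) (v2 : V2) : Prop :=
  forall l, d1 v1 (lab1 l) = d2 v2 (lab2 l).

Hypothesis same_labels : forall i, same_profile (lab1 i) (lab2 i).

(** [v1] is the median of three labels. The median of the same labels in the
    other tree has the same distances to the labels, by [tdist_median]. *)
Lemma ex_same_profile v1 : exists v2, same_profile v1 v2.
Proof.
have [i [j [k [ij jk ik]]]] := median_of_labels T1 deg1 v1.
have [v2 [ij2 ik2 jk2]] := median T2 (lab2 i) (lab2 j) (lab2 k).
exists v2 => l.
have m1 := tdist_median len1C len1_gt0 (lab1 l) ij jk ik.
have m2 := tdist_median len2C len2_gt0 (lab2 l) ij2 jk2 ik2.
have : 2 * d1 v1 (lab1 l) = 2 * d2 v2 (lab2 l).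
  by rewrite m1 m2 !same_labels.
lra.
Qed.

(** A label [l] beyond [v1] seen from [u1] realizes the distance as a
    difference of two entries of the profiles. *)
Lemma same_profile_le u1 u2 v1 v2 :
  same_profile u1 u2 -> same_profile v1 v2 -> d1 u1 v1 <= d2 u2 v2.
Proof.
move=> pu pv; have [i /(tdist_btw len1)] := label_beyond T1 deg1 u1 v1.
rewrite pu pv; have := tdist_triangle T2 len2C len2_gt0 u2 v2 (lab2 i); lra.
Qed.
End Match.

Section Uniqueness.
Variables (V1 V2 : finType) (e1 : rel V1) (e2 : rel V2).
Variables (len1 : V1 -> V1 -> R) (len2 : V2 -> V2 -> R).
Hypotheses (T1 : is_tree e1) (T2 : is_tree e2).
Hypothesis len1C : forall u v, len1 u v = len1 v u.
Hypothesis len2C : forall u v, len2 u v = len2 v u.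
Hypothesis len1_gt0 : forall u v, e1 u v -> 0 < len1 u v.
Hypothesis len2_gt0 : forall u v, e2 u v -> 0 < len2 u v.
Variables (lab1 : X -> V1) (lab2 : X -> V2).
Hypothesis deg1 : forall v, (degree e1 v <= 2)%N -> exists i, lab1 i = v.
Hypothesis deg2 : forall v, (degree e2 v <= 2)%N -> exists i, lab2 i = v.
Hypothesis same_labels : forall i j,
  tdist len1 T1 (lab1 i) (lab1 j) = tdist len2 T2 (lab2 i) (lab2 j).

(** Profiles identify the vertices of the two trees. This identification is an
    isometry, so it preserves betweenness and therefore adjacency. *)
Theorem tree_metric_unique : exists psi : V1 -> V2,
  [/\ bijective psi, forall i, psi (lab1 i) = lab2 i
    & forall u v, e1 u v = e2 (psi u) (psi v)].
Proof.
pose prof := same_profile len1 len2 T1 T2 lab1 lab2.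
pose prof' := same_profile len2 len1 T2 T1 lab2 lab1.
have profC v1 v2 : prof v1 v2 -> prof' v2 v1 by move=> p l; rewrite p.
have iso u1 u2 v1 v2 : prof u1 u2 -> prof v1 v2 ->
    tdist len1 T1 u1 v1 = tdist len2 T2 u2 v2.
  move=> pu pv; apply/le_anti/andP; split.
    exact: (same_profile_le len2C len2_gt0 deg1 pu pv).
  by apply: (same_profile_le len1C len1_gt0 deg2); apply: profC.
have /choice[psi psiP] : forall v1, exists v2, prof v1 v2.
  by move=> v1; apply: ex_same_profile.
have /choice[psi' psi'P] : forall v2, exists v1, prof' v2 v1.
  by move=> v2; apply: ex_same_profile => // i l; rewrite same_labels.
have uniq2 v1 u2 v2 : prof v1 u2 -> prof v1 v2 -> u2 = v2.
  move=> p q; apply: (tdist_eq0 len2_gt0 (treeT := T2)).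
  by rewrite -(iso _ _ _ _ p q) tdistxx.
have uniq1 u1 v1 v2 : prof u1 v2 -> prof v1 v2 -> u1 = v1.
  move=> p q; apply: (tdist_eq0 len1_gt0 (treeT := T1)).
  by rewrite (iso _ _ _ _ p q) tdistxx.
have psi'P' v2 : prof (psi' v2) v2 by move=> l; rewrite psi'P.
have K1 : cancel psi psi' by move=> v; apply: uniq1 (psi'P' _) (psiP _).
have K2 : cancel psi' psi by move=> v; apply: uniq2 (psiP _) (psi'P' _).
exists psi; split; first by exists psi'.
  by move=> i; apply: uniq2 (psiP _) _ => l; rewrite same_labels.
have btw_psi u z v : btw T1 u z v = btw T2 (psi u) (psi z) (psi v).
  rewrite (btwE T1 len1C len1_gt0) (btwE T2 len2C len2_gt0).
  by rewrite !(iso _ _ _ _ (psiP _) (psiP _)).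
move=> u v; apply/(edge_btwP T1)/(edge_btwP T2) => -[uv noz]; split.
- by rewrite (can_eq K1).
- move=> z; rewrite -[z]K2 -btw_psi => /noz[] ->; by [left|right].
- by apply: contra_neq uv => ->.
- by move=> z; rewrite btw_psi => /noz[] /(can_inj K1); [left|right].
Qed.
End Uniqueness.
End TwoTrees.

(** * Regions cut off by a vertex *)

Section Regions.
Variables (V : finType) (e : rel V).
Hypothesis treeT : is_tree e.

Notation btw := (btw treeT).

Let e_sym : symmetric e. Proof. by case: treeT. Qed.

(** A union of connected components of the tree without [w]. Every bag that
    the algorithm forms consists of [w] and the labels in such a set. *)
Definition region (w : V) (U : {set V}) : Prop :=
  w \notin U /\ forall u v, u \in U -> e u v -> v != w -> v \in U.

Lemma region_sep w U u v : region w U -> u \in U -> v \notin U -> btw u w v.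
Proof.
case=> _ clU uU vU; apply: contraR vU; rewrite /btw inE negb_or => /andP[_].
suff H : w \notin spath treeT u v -> last u (spath treeT u v) \in U.
  by move=> /H; rewrite last_spath.
move: (spath treeT u v) (path_spath treeT u v) => p.
elim: p u uU => //= x p IHp u uU /andP[eux epx]; rewrite inE negb_or eq_sym => /andP[xw wp].
exact: IHp (clU _ _ uU eux xw) epx wp.
Qed.

Lemma region_convex w U u v x :
  region w U -> u \in w |: U -> v \in w |: U -> btw u x v -> x \in w |: U.
Proof.
move=> rU uU vU uxv; rewrite !inE; apply/norP => -[xw xU].
have sep y : y \in w |: U -> btw x w y.
  rewrite !inE => /orP[/eqP->|yU]; first exact: btw_r.
  by rewrite btwC; exact: region_sep rU yU xU.
have [uxw|wxv] := btw_split w uxv.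
  have := btw_anti (_ : btw x w u) (_ : btw w x u); rewrite btwC in uxw.
  by move=> /(_ (sep _ uU) uxw) xwE; rewrite xwE eqxx in xw.
by have xwE := btw_anti (sep _ vU) wxv; rewrite xwE eqxx in xw.
Qed.

(** [U] contains all that lies beyond one of its vertices, seen from [w]. *)
Lemma region_label (X : Type) (lab : X -> V) w U :
  (forall v, (degree e v <= 2)%N -> exists i, lab i = v) ->
  region w U -> U != finset.set0 -> exists i, lab i \in U.
Proof.
move=> deg_lab rU /set0Pn[u uU].
have [i wui] := label_beyond treeT deg_lab w u; exists i.
apply: contraT => iU; have uwi := region_sep rU uU iU.
by case: rU => /negP[]; rewrite (btw_anti wui uwi).
Qed.

Lemma region_branch w U u :
  region w U -> region w [set v in U | ~~ btw u w v].
Proof.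
move=> rU; have [wU clU] := rU; split=> [|x y]; rewrite !inE; first by rewrite (negPf wU).
case/andP=> xU nx exy yw; rewrite (clU _ _ xU exy yw) /=.
apply: contra nx => /(btw_split x)[//|]; rewrite btw_edge //.
case/orP=> [/eqP wx|/eqP wy]; first by rewrite wx xU in wU.
by rewrite wy eqxx in yw.
Qed.

Lemma region_diff w U U1 :
  region w U -> region w U1 -> region w (U :\: U1).
Proof.
move=> [wU clU] [wU1 clU1]; split=> [|x y]; rewrite !inE; first by rewrite (negPf wU) andbF.
case/andP=> xU1 xU exy yw; rewrite (clU _ _ xU exy yw) andbT.
apply: contra xU1 => yU1; apply: (clU1 y) => //; first by rewrite e_sym.
by apply: contraNneq wU => <-.
Qed.

(** [x] is the projection of [v] to the path from [w] to [a]. *)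
Definition hangs w a x v := btw w x v && btw a x v.

Lemma hangs_ex w a v : exists2 x, btw w x a & hangs w a x v.
Proof.
have [x [wxa wxv axv]] := median treeT w a v.
by exists x; rewrite // /hangs wxv axv.
Qed.

Lemma hangs_uniq w a x y v :
  btw w x a -> btw w y a -> hangs w a x v -> hangs w a y v -> x = y.
Proof.
wlog wxy : x y / btw w x y => [IH|] wxa wya.
  case: (btw_total wxa wya) => [wxy|wyx] hx hy; first exact: IH.
  by apply/esym; apply: IH.
case/andP=> wxv axv /andP[wyv ayv].
have xya := btw_trans_r wxy wya; rewrite btwC in xya.
have yxv := btw_trans_r xya axv.
exact: btw_anti (btw_trans_r wxy wyv) yxv.
Qed.

Lemma hangs_self w a x : hangs w a x x.
Proof. by rewrite /hangs !btw_r. Qed.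

Definition hanging w a (U : {set V}) x := [set v in U | (v != x) && hangs w a x v].

(** A neighbour of [v] other than [x] is on the same side of [x] as [v], so it
    has the same projection. *)
Lemma region_hanging w a U x :
  region w U -> a \in U -> btw w x a -> region x (hanging w a U x).
Proof.
move=> rU aU wxa; have [wU clU] := rU; split=> [|v y]; rewrite !inE; first by rewrite eqxx andbF.
case/and3P=> vU vx /andP[wxv axv] evy yx.
have keep z : btw z x v -> btw z x y.
  move=> /(btw_split y)[//|]; rewrite btwC btw_edge // => /orP[] /eqP xE.
    by rewrite xE eqxx in vx.
  by rewrite xE eqxx in yx.
rewrite yx /hangs !keep //= andbT; apply: (clU v) => //.
by apply: contraNneq yx => yw; have := keep _ wxv; rewrite yw btw_id eq_sym.
Qed.

Lemma spath_adjacent w a u v :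
  e u v -> btw w u a -> btw w v a -> btw w u v ->
  exists s1 s2, w :: spath treeT w a = s1 ++ u :: v :: s2.
Proof.
move=> euv wua wva wuv.
have uva := btw_trans_r wuv wva.
exists (belast w (spath treeT w u)), (spath treeT v a).
rewrite (spath_btw wua) (spath_btw uva) (spath_edge treeT euv) -cat_cons.
rewrite -[RHS]cat_rcons.
by have := lastI w (spath treeT w u); rewrite last_spath => <-.
Qed.

End Regions.

Lemma mem_zip_behead (T : eqType) (s : seq T) x y :
  reflect (exists s1 s2, s = s1 ++ x :: y :: s2) ((x, y) \in zip s (behead s)).
Proof.
apply: (iffP idP) => [|[s1 [s2 ->]]].
  elim: s => //= a [//|b s] IHs /=; rewrite inE => /orP[/eqP[-> ->]|/IHs].
    by exists [::], s.
  by case=> s1 [s2 ->]; exists (a :: s1), s2.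
elim: s1 => [|a s1 IHs] /=; first by rewrite mem_head.
by case: s1 IHs => [|b s1] /= IHs; rewrite inE IHs orbT.
Qed.

(** * Partially resolved bags *)

Section Resolution.
Variables (R : realType) (V : finType) (e : rel V) (n : nat) (lab : 'I_n -> V).
Variable len : V -> V -> R.
Hypothesis treeT : is_tree e.

Notation btw := (btw treeT).
Notation dist := (tdist len treeT).
Notation bag := (bag n R).

Let e_sym : symmetric e. Proof. by case: treeT. Qed.

Definition labels_in (U : {set V}) : {set 'I_n} := [set i | lab i \in U].

Definition names_labels (phi : V -> node n) : Prop :=
  forall v i, phi v = inl i <-> v = lab i.

(** The bag [b] stands for the subtree on [w] and the region [U]; the recorded
    distances are only constrained where they are read. *)
Definition encodes (phi : V -> node n) (b : bag) (w : V) (U : {set V}) : Prop :=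
  [/\ region e w U, phi w = brep b, bothers b = labels_in U
    & forall j i, brep b = inr j -> i \in bothers b -> bdrep b i = dist (lab i) w].

(** The bags encode disjoint regions with union [U] and with top vertices in
    [A]. Removing the regions one after the other makes disjointness part of
    the recursion. *)
Fixpoint covers (phi : V -> node n) (A : {set V}) (bs : seq bag) (U : {set V}) : Prop :=
  if bs isn't b :: bs' then U = finset.set0 else
  exists w (U1 : {set V}), [/\ encodes phi b w U1, w \in A, U1 \subset U
                 & covers phi A bs' (U :\: U1)].

Lemma covers_cat phi A bs1 bs2 U :
  covers phi A (bs1 ++ bs2) U <->
  exists U1 : {set V}, [/\ U1 \subset U, covers phi A bs1 U1 & covers phi A bs2 (U :\: U1)].
Proof.
elim: bs1 U => [|b bs1 IHbs] U /=.
  split=> [cU|[U1 [_ -> ]]]; last by rewrite finset.setD0.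
  by exists finset.set0; rewrite finset.sub0set finset.setD0.
split=> [[w [U1 [enc wA sU1 /IHbs[U2 [sU2 c1 c2]]]]]|].
  exists (U1 :|: U2); split.
  - rewrite finset.subUset sU1 (fintype.subset_trans sU2) //.
    exact: finset.subsetDl.
  - exists w, U1; split=> //; first exact: finset.subsetUl.
    rewrite finset.setDUl finset.setDv finset.set0U.
    suff -> : U2 :\: U1 = U2 by [].
    by apply/finset.setDidPl; move: sU2; rewrite finset.subsetD => /andP[].
  - by rewrite -finset.setDDl.
case=> U2 [sU2 [w [U1 [enc wA sU1 c1]]] c2].
exists w, U1; split=> //; first exact: fintype.subset_trans sU1 sU2.
apply/IHbs; exists (U2 :\: U1); split=> //; first exact: finset.setSD.
suff -> : U :\: U1 :\: (U2 :\: U1) = U :\: U2 by [].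
apply/setP=> v; rewrite !inE; case: (boolP (v \in U1)) => [vU1|] /=; last by case: (v \in U).
by rewrite (fintype.subsetP sU1 _ vU1).
Qed.

Lemma coversC phi A bs1 bs2 U :
  covers phi A (bs1 ++ bs2) U -> covers phi A (bs2 ++ bs1) U.
Proof.
move=> /covers_cat[U1 [sU1 c1 c2]]; apply/covers_cat.
exists (U :\: U1); split=> //; first exact: finset.subsetDl.
by rewrite finset.setDDr finset.setDv finset.set0U (finset.setIidPr sU1).
Qed.

Lemma coversW (phi phi' : V -> node n) (A A' : {set V}) bs U :
  {in A, phi =1 phi'} -> A \subset A' -> covers phi A bs U -> covers phi' A' bs U.
Proof.
move=> eqphi sA; elim: bs U => //= b bs IHbs U [w [U1 [[r pw bE dE] wA sU1 /IHbs c]]].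
exists w, U1; split=> //; last exact: fintype.subsetP wA.
by split=> //; rewrite -eqphi.
Qed.

Lemma covers_map (T : eqType) (s : seq T) (b : T -> bag) (w : T -> V)
    (reg : T -> {set V}) phi (A U : {set V}) :
  uniq s ->
  (forall i, i \in s -> [/\ encodes phi (b i) (w i) (reg i), w i \in A & reg i \subset U]) ->
  (forall v, v \in U -> exists2 i, i \in s & v \in reg i) ->
  (forall i j v, i \in s -> j \in s -> v \in reg i -> v \in reg j -> i = j) ->
  covers phi A [seq b i | i <- s] U.
Proof.
elim: s U => [|i s IHs] U /=.
  move=> _ _ cU _; apply/setP=> v; rewrite finset.in_set0.
  by apply/negP => /cU[].
case/andP=> is_ us enc cU disj; exists (w i), (reg i).
have [ei wi si] := enc i (mem_head _ _); split=> //; apply: IHs => //.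
- move=> j js; have [ej wj sj] := enc j (mem_behead (s := i :: s) js); split=> //.
  apply/fintype.subsetP => v vj; rewrite inE (fintype.subsetP sj) // andbT.
  apply: contra is_ => vi; rewrite (disj i j v) //; first exact: mem_head.
  by rewrite inE js orbT.
- move=> v; rewrite inE => /andP[vi /cU[j]]; rewrite inE => /orP[/eqP ->|js vj].
    by rewrite (negPf vi).
  by exists j.
- by move=> j k v js ks; apply: disj; rewrite inE ?js ?ks orbT.
Qed.

(** A stage of the treatment of a bag with top vertex [w] and region [U1], where
    [k0] and [phi0] are the first unused name and the naming at the beginning.
    The vertices in [U1 :\: U] have their final names; [E] consists of the edges
    between them and [w]; the bags [bs] cover what remains. On [U] the naming is
    still [phi0]. A whole run of the algorithm, one pass
    of BIGSPLIT, BASIC and the solution of a small bag are all instances. *)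
Record resolution (w : V) (U1 : {set V}) (k0 : nat) (phi0 : V -> node n)
    (bs : seq bag) (E : seq (node n * node n)) (k : nat)
    (phi : V -> node n) (U : {set V}) : Prop := Resolution {
  res_top : w \notin U1;
  res_old : forall j, phi0 w = inr j -> (j < k0)%N;
  res_sub : U \subset U1;
  res_names : names_labels phi;
  res_keep : forall v, v \notin U1 :\: U -> phi v = phi0 v;
  res_fresh : (k0 <= k)%N /\
    forall v j, v \in U1 :\: U -> phi v = inr j -> (k0 <= j < k)%N;
  res_inj : {in U1 :\: U &, injective phi};
  res_covers : covers phi (w |: (U1 :\: U)) bs U;
  res_sound : forall x y, (x, y) \in E -> exists u v,
    [/\ u \in w |: (U1 :\: U), v \in w |: (U1 :\: U), e u v, x = phi u & y = phi v];
  res_complete : forall u v, u \in U1 :\: U -> v \in w |: (U1 :\: U) -> e u v ->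
    ((phi u, phi v) \in E) || ((phi v, phi u) \in E) }.

Lemma resolution_refl phi b w U k :
  names_labels phi -> encodes phi b w U -> (forall j, phi w = inr j -> (j < k)%N) ->
  resolution w U k phi [:: b] [::] k phi U.
Proof.
move=> nm enc old; have DE : U :\: U = finset.set0 by rewrite finset.setDv.
case: (enc) => -[wU _] _ _ _; split; rewrite ?DE //.
- by split=> // v j; rewrite finset.in_set0.
- by move=> u v; rewrite finset.in_set0.
- by exists w, U; rewrite finset.setDv !inE eqxx.
- by move=> u v; rewrite finset.in_set0.
Qed.

Lemma resolutionC w U1 k0 phi0 bs1 bs2 E k phi U :
  resolution w U1 k0 phi0 (bs1 ++ bs2) E k phi U ->
  resolution w U1 k0 phi0 (bs2 ++ bs1) E k phi U.
Proof. by case=> *; split=> //; apply: coversC. Qed.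

(** Stages compose: a stage reached from the first bag can be substituted for
    this bag. The names that the inner stage introduces lie above those in use,
    and an edge that leaves the region [U'] of the bag ends at its top [w']. *)
Lemma resolution_comp w U1 k0 phi0 b bs E k phi U :
  resolution w U1 k0 phi0 (b :: bs) E k phi U ->
  exists w' (U' : {set V}), [/\ encodes phi b w' U', U' \subset U, w' \notin U,
    (forall j, phi w' = inr j -> (j < k)%N) &
    forall news E' k' phi' U'',
      resolution w' U' k phi news E' k' phi' U'' ->
      resolution w U1 k0 phi0 (news ++ bs) (E ++ E') k' phi' ((U :\: U') :|: U'')].
Proof.
case=> wU1 old sU nm keep [lek fresh] inj /= [w' [U' [enc w'A sU' cov]]] snd cpl.
have w'U : w' \notin U.
  by move: w'A; rewrite !inE => /orP[/eqP ->|/andP[]//]; apply: contra wU1; apply: fintype.subsetP.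
exists w', U'; split=> //.
  move=> j; move: w'A; rewrite finset.in_setU finset.in_set1 => /orP[/eqP ->|w'D].
    rewrite keep; last by rewrite inE (negPf wU1) andbF.
    by move/old => jk; apply: leq_trans jk lek.
  by move=> /(fresh _ _ w'D)/andP[].
move=> news E' k' phi' U''.
case=> w'U' old' sU'' nm' keep' [lek' fresh'] inj' cov' snd' cpl'.
set Un := (U :\: U') :|: U''.
have inU' v : v \in U' -> v \in U by exact: fintype.subsetP.
have inU v : v \in U -> v \in U1 by exact: fintype.subsetP.
have inU'' v : v \in U'' -> v \in U' by exact: fintype.subsetP.
have DE v : (v \in U1 :\: Un) = (v \in U1 :\: U) || (v \in U' :\: U'').
  rewrite !inE; have := inU v; have := inU' v; have := inU'' v.
  case: (v \in U''); case: (v \in U'); case: (v \in U); case: (v \in U1) => //=;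
    do ?[by move=> _ _ /(_ isT) | by move=> _ /(_ isT) | by move=> /(_ isT)].
have phiE v : v \in w |: (U1 :\: U) -> phi' v = phi v.
  move=> vA; apply: keep'; rewrite !inE; apply/negP => /andP[_ /inU' vU].
  move: vA; rewrite !inE vU orbF => /eqP vw.
  by rewrite vw in vU; rewrite (inU _ vU) in wU1.
have DU1 v : v \in U1 :\: U -> v \in w |: (U1 :\: U) by move=> vD; rewrite finset.in_setU vD orbT.
have subA v : v \in w |: (U1 :\: U) -> v \in w |: (U1 :\: Un).
  by rewrite !finset.in_setU DE => /orP[->|->]; rewrite ?orbT.
have subA' v : v \in w' |: (U' :\: U'') -> v \in w |: (U1 :\: Un).
  rewrite finset.in_setU finset.in_set1 => /orP[/eqP ->|vD]; first exact: subA.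
  by rewrite finset.in_setU DE vD !orbT.
split=> //.
- apply/fintype.subsetP => v; rewrite !inE => /orP[/andP[_ /inU]//|/inU''/inU'/inU//].
- by move=> v; rewrite DE negb_or => /andP[v1 /keep' ->]; apply: keep.
- split; first exact: leq_trans lek lek'.
  move=> v j; rewrite DE => /orP[vD|vD].
    rewrite phiE ?DU1 // => /(fresh _ _ vD)/andP[-> jk]; exact: leq_trans jk lek'.
  by move=> /(fresh' _ _ vD)/andP[kj ->]; rewrite (leq_trans lek kj).
- have cross u v : u \in U1 :\: U -> v \in U' :\: U'' -> phi' u = phi' v -> u = v.
    move=> uD vD; case E1 : (phi' v) => [i|j] E2.
      by move/nm': E1 => ->; move/nm': E2.
    have /andP[kj _] := fresh' _ _ vD E1.
    rewrite phiE ?DU1 // in E2.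
    by have /andP[_] := fresh _ _ uD E2; rewrite ltnNge kj.
  move=> u v; rewrite !DE => /orP[uD|uD] /orP[vD|vD] phiuv.
  + by apply: inj; rewrite // -!phiE ?DU1.
  + exact: cross.
  + by apply/esym/cross.
  + exact: inj'.
- apply/covers_cat; exists U''; split; first exact: finset.subsetUr.
    by apply: coversW cov' => //; apply/fintype.subsetP => v; apply: subA'.
  suff -> : Un :\: U'' = U :\: U'.
    apply: coversW cov => [v vA|]; first by rewrite phiE.
    by apply/fintype.subsetP => v; apply: subA.
  apply/setP=> v; rewrite !inE; have := inU'' v.
  by case: (v \in U'') => //= [/(_ isT) ->|_] //; rewrite orbF.
- move=> x y; rewrite mem_cat => /orP[/snd|/snd'] [u [v [uA vA euv -> ->]]].
    by exists u, v; rewrite !phiE ?subA.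
  by exists u, v; rewrite !subA'.
- have half u v : u \in U' :\: U'' -> v \in w |: (U1 :\: Un) -> e u v ->
      ((phi' u, phi' v) \in E ++ E') || ((phi' v, phi' u) \in E ++ E').
    move=> uD vA euv; rewrite !mem_cat.
    have vA' : v \in w' |: (U' :\: U'').
      rewrite finset.in_setU finset.in_set1; have [//|vw'] := eqVneq v w'.
      have [_ clU'] : region e w' U' by case: enc.
      have uU' : u \in U' by move: uD; rewrite inE => /andP[].
      have vU' := clU' _ _ uU' euv vw'.
      move: vA; rewrite finset.in_setU finset.in_set1 => /orP[/eqP vw|].
        by rewrite -vw (inU _ (inU' _ vU')) in wU1.
      by rewrite DE => /orP[|//]; rewrite inE (inU' _ vU').
    by have /orP[->|->] := cpl' _ _ uD vA' euv; rewrite !orbT.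
  move=> u v; rewrite DE => /orP[uD|uD] vA euv; last exact: half.
  have [vA'|vA'] := boolP (v \in U' :\: U'').
    by rewrite orbC; apply: half; rewrite ?subA ?DU1 // e_sym.
  have vA1 : v \in w |: (U1 :\: U).
    by move: vA; rewrite !finset.in_setU DE (negPf vA') orbF.
  rewrite !mem_cat (phiE _ vA1) (phiE _ (DU1 _ uD)).
  by have /orP[->|->] := cpl _ _ uD vA1 euv; rewrite ?orbT.
Qed.

End Resolution.

(** * Distances inside a bag, and EXPLODE *)

Section Operations.
Variables (R : realType) (V : finType) (e : rel V) (n : nat) (lab : 'I_n -> V).
Variable len : V -> V -> R.
Hypothesis treeT : is_tree e.
Hypothesis deg_lab : forall v, (degree e v <= 2)%N -> exists i, lab i = v.
Hypothesis len_sym : forall u v, len u v = len v u.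
Hypothesis len_gt0 : forall u v, e u v -> 0 < len u v.
Variables (d : 'I_n -> 'I_n -> R) (c : choices n R).

Notation btw := (btw treeT).
Notation dist := (tdist len treeT).
Notation bag := (bag n R).
Notation names_labels := (names_labels lab).
Notation encodes := (encodes lab len treeT).
Notation resolution := (resolution lab len treeT).
Notation covers := (covers lab len treeT).
Notation labels_in := (labels_in lab).

Hypothesis dE : forall i j, d i j = dist (lab i) (lab j).

Let e_irr : irreflexive e. Proof. by case: treeT. Qed.
Let distC u v : dist u v = dist v u. Proof. exact: tdistC. Qed.

(** The vertices of the tree that are elements of the bag. *)
Definition elts (w : V) (U : {set V}) : {set V} :=
  w |: [set v in U | [exists i, lab i == v]].

Lemma eltsP w (U : {set V}) x : reflect (x = w \/ exists2 i, lab i = x & x \in U) (x \in elts w U).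
Proof.
rewrite !inE; apply: (iffP orP) => -[/eqP xw|]; [by left| |by left|].
  by case/andP=> xU /existsP[i /eqP ix]; right; exists i.
by case=> i ix xU; right; rewrite xU; apply/existsP; exists i; rewrite ix.
Qed.

Lemma elts_top w U : w \in elts w U. Proof. by apply/eltsP; left. Qed.

Lemma elts_lab w (U : {set V}) i : lab i \in U -> lab i \in elts w U.
Proof. by move=> iU; apply/eltsP; right; exists i. Qed.

Lemma elts_sub w (U : {set V}) x : x \in elts w U -> x \in w |: U.
Proof. by rewrite !inE => /orP[->|/andP[->]] //; rewrite orbT. Qed.

Section OneBag.
Variables (phi : V -> node n) (b : bag) (w : V) (U : {set V}).
Hypotheses (nm : names_labels phi) (enc : encodes phi b w U).

Lemma names_lab i : phi (lab i) = inl i.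
Proof. by apply/nm. Qed.

Lemma belts_elts v : v \in belts b -> exists2 x, x \in elts w U & phi x = v.
Proof.
have [_ pw bE _] := enc; rewrite inE -pw => /orP[/eqP ->|].
  by exists w => //; exact: elts_top.
case/mapP=> i; rewrite mem_enum bE inE => iU ->; exists (lab i); first exact: elts_lab.
exact: names_lab.
Qed.

Lemma elts_belts x : x \in elts w U -> phi x \in belts b.
Proof.
have [_ pw bE _] := enc; case/eltsP => [->|[i <- iU]].
  by rewrite pw mem_head.
by rewrite inE names_lab map_f ?orbT // mem_enum bE inE.
Qed.

Lemma elts_inr x j : x \in elts w U -> phi x = inr j -> x = w.
Proof. by case/eltsP => [->//|[i <- _]]; rewrite names_lab. Qed.

Lemma elts_inj : {in elts w U &, injective phi}.
Proof.
move=> x y xE yE; case E : (phi y) => [i|j] E'.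
  by move/nm: E => ->; move/nm: E'.
by rewrite (elts_inr xE E') (elts_inr yE E).
Qed.

Lemma bdistE x y : x \in elts w U -> y \in elts w U ->
  bdist d b (phi x) (phi y) = dist x y.
Proof.
have [_ pw bE rE] := enc.
have half u j i : u \in elts w U -> phi u = inl i -> phi w = inr j ->
    bdrep b i = dist u w.
  move=> uE ui wj; have uE' := (iffLR (nm _ _)) ui; rewrite uE'.
  apply: (rE j); first by rewrite -pw.
  rewrite bE inE -uE'; case/eltsP: uE => [uw|[]//].
  by rewrite -uw ui in wj.
move=> xE yE; case Ex : (phi x) => [i|j]; case Ey : (phi y) => [i'|j'] /=.
- by move/nm: Ex => ->; move/nm: Ey => ->.
- by have yw := elts_inr yE Ey; rewrite yw in Ey *; apply: half Ex Ey.
- by have xw := elts_inr xE Ex; rewrite xw distC in Ex *; apply: half Ey Ex.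
- by rewrite (elts_inr xE Ex) (elts_inr yE Ey) tdistxx.
Qed.

Lemma bothers0 : bothers b = finset.set0 -> U = finset.set0.
Proof.
have [rU _ -> _] := enc => U0; apply/eqP/contraT => /(region_label treeT deg_lab rU)[i iU].
by move/setP: U0 => /(_ i); rewrite !inE iU.
Qed.

End OneBag.

Definition is_branch (r : V) (A : {set 'I_n}) : bool :=
  [exists x, A == [set i | btw r x (lab i)]].

(** The component of [u] in the tree without [w] is the set of vertices beyond
    the first step [x] from [w] to [u]. It does not contain [r], so it is also
    what [x] separates from [r]. With [r] fixed, the bags that a pass produces
    are therefore sets of descendants in one rooted tree. *)
Lemma branch_is_branch w (U : {set V}) u r : region e w U -> u \in U -> r \notin U ->
  is_branch r (labels_in [set v in U | ~~ btw u w v]).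
Proof.
move=> rU uU rU'; have wu : w != u by case: rU => wU _; apply: contraNneq wU => ->.
have [x ewx wxu] := first_step treeT wu; apply/existsP; exists x; apply/eqP/setP => i.
rewrite !inE; set v := lab i.
have sideu : ~~ btw x w u by rewrite (edge_btwN treeT) // negbK.
have sep_x y : btw x w y = btw u w y.
  apply/idP/idP => [|uwy].
    by move=> /(btw_split u)[xwu|//]; rewrite xwu in sideu.
  by have [|//] := btw_split x uwy; rewrite btwC => xwu; rewrite xwu in sideu.
have xwr : btw x w r by rewrite sep_x; exact: (region_sep treeT rU uU rU').
have xrw : ~~ btw w x r by rewrite -(edge_btwN treeT).
rewrite -sep_x (edge_btwN treeT) // negbK.
apply/andP/idP => [[_ wxv]|rxv].
  have [wxr|//] := btw_split r wxv; by rewrite wxr in xrw.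
have [rxw|wxv] := btw_split w rxv; first by rewrite btwC rxw in xrw.
split=> //; apply: contraT => vU.
have := region_sep treeT rU uU vU; rewrite -sep_x => xwv.
by have wx := btw_anti xwv wxv; rewrite wx e_irr in ewx.
Qed.

(** The test of EXPLODE is [btw_ltE]: it selects the labels in the component of
    the chosen element. *)
Lemma explode_rec_covers fuel (b : bag) phi w (A U : {set V}) r :
  names_labels phi -> (#|bothers b| <= fuel)%N -> r \notin U ->
  encodes phi b w U -> w \in A ->
  covers phi A (explode_rec d c fuel b) U /\
  all (fun b' => (bothers b' != finset.set0) && is_branch r (bothers b'))
    (explode_rec d c fuel b).
Proof.
move=> nm; elim: fuel b U => [|fuel IH] b U /=.
  rewrite leqn0 cards_eq0 => /eqP b0 _ enc _.
  by rewrite (bothers0 enc b0).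
move=> bf rU enc wA; case: ifPn => [/eqP b0|bn0] /=; first by rewrite (bothers0 enc b0).
have [regU pw bE rE] := enc.
set i := ch_take c b; have ib : i \in bothers b by exact: ch_takeP.
have iU : lab i \in U by move: ib; rewrite bE inE.
set Bs := [set v in bothers b | _]; set U1 := [set v in U | ~~ btw (lab i) w v].
have key j : lab j \in U ->
    (bdist d b (inl i) (inl j) < bdist d b (inl i) (brep b) + bdist d b (inl j) (brep b))
    = ~~ btw (lab i) w (lab j).
  move=> jU; rewrite -!(names_lab nm) -pw !(bdistE nm enc) ?elts_top ?elts_lab //.
  by rewrite (btw_ltE treeT len_sym len_gt0) negbK [dist (lab j) w]distC.
have BsE : Bs = labels_in U1.
  apply/setP=> j; rewrite !inE bE inE.
  by case: (boolP (lab j \in U)) => //= /key.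
have regU1 : region e w U1 by exact: region_branch.
have sU1 : U1 \subset U by apply/fintype.subsetP => v; rewrite inE => /andP[].
have uU1 : lab i \in U1.
  by rewrite inE iU btw_id; apply: contraTneq iU => <-; case: regU.
have encB : encodes phi (Bag (brep b) Bs (bdrep b)) w U1.
  split=> //= j k bj; rewrite BsE inE => kU1; apply: (rE j) => //.
  by rewrite bE inE (fintype.subsetP sU1).
have encD : encodes phi (Bag (brep b) (bothers b :\: Bs) (bdrep b)) w (U :\: U1).
  split=> //=; first exact: region_diff.
    by apply/setP=> k; rewrite BsE bE !inE.
  by move=> j k bj; rewrite inE => /andP[_ kb]; apply: (rE j).
have fD : (#|bothers b :\: Bs| <= fuel)%N.
  rewrite -ltnS; apply: leq_trans bf; apply/proper_card/properP; split.
    exact: finset.subsetDl.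
  by exists i; rewrite // inE BsE inE uU1.
have rD : r \notin U :\: U1 by rewrite inE (negPf rU) andbF.
have [cD aD] := IH (Bag (brep b) (bothers b :\: Bs) (bdrep b)) _ fD rD encD wA.
split; first by exists w, U1.
rewrite aD andbT BsE branch_is_branch // andbT.
by apply/set0Pn; exists i; rewrite inE.
Qed.

Lemma explode_covers phi (A U : {set V}) bs r :
  names_labels phi -> r \notin U -> covers phi A bs U ->
  covers phi A (flatten [seq explode d c b | b <- bs]) U /\
  all (fun b => (bothers b != finset.set0) && is_branch r (bothers b))
    (flatten [seq explode d c b | b <- bs]).
Proof.
move=> nm; elim: bs U => //= b bs IH U rU [w [U1 [enc wA sU1 /IH[]]]].
  by rewrite inE (negPf rU) andbF.
have rU1 : r \notin U1 by apply: contra rU; apply: fintype.subsetP.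
have [c1 a1] := explode_rec_covers nm (leqnn _) rU1 enc wA.
move=> c2 a2; rewrite all_cat a1 a2; split=> //.
by apply/covers_cat; exists U1.
Qed.

Lemma covers_sub phi (A U : {set V}) bs :
  covers phi A bs U -> all (fun b => bothers b \subset labels_in U) bs.
Proof.
elim: bs U => //= b bs IH U [w [U1 [[_ _ -> _] _ sU1 /IH ab]]].
apply/andP; split.
  by apply/fintype.subsetP => i; rewrite !inE; apply: fintype.subsetP.
apply: sub_all ab => b' /fintype.subset_trans; apply.
by apply/fintype.subsetP => i; rewrite !inE => /andP[].
Qed.

Lemma covers_card phi (A U : {set V}) bs :
  covers phi A bs U -> (\sum_(b <- bs) #|bothers b|)%N = #|labels_in U|.
Proof.
elim: bs U => [|b bs IH] U /=.
  move=> ->; rewrite big_nil; apply/esym/eqP; rewrite cards_eq0.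
  by apply/eqP/setP => i; rewrite !inE.
case=> w [U1 [[_ _ bE _] _ sU1 /IH IHE]]; rewrite big_cons IHE bE.
have sL : labels_in U1 \subset labels_in U.
  by apply/fintype.subsetP => i; rewrite !inE; apply: fintype.subsetP.
rewrite -(cardsID (labels_in U1) (labels_in U)) (finset.setIidPr sL).
by congr (_ + #|pred_of_set _|)%N; apply/setP => i; rewrite !inE.
Qed.
End Operations.

(** * Small bags solved from their distance matrix *)

Section SmallBags.
Variables (R : realType) (n : nat) (b : bag n R) (D : node n -> node n -> R).

(** The data hidden by the existential quantifiers of [tree_on]. *)
Definition realizes (k : nat) (F : seq (node n * node n)) (k' : nat)
    (V : finType) (e : rel V) (phi : V -> node n) (len : V -> V -> R) : Prop :=
  [/\ is_tree e, injective phi & edges_named e phi F] /\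
  [/\ (k <= k')%N,
      (forall x, x \in belts b -> exists v, phi v = x),
      (forall v, phi v \notin belts b ->
         exists j, phi v = inr j /\ (k <= j < k')%N)
    & (forall v, (degree e v <= 2)%N -> phi v \in belts b)] /\
  [/\ (forall u v, len u v = len v u),
      (forall u v, e u v -> 0 < len u v)
    & (forall u v p, phi u \in belts b -> phi v \in belts b ->
         simple_path e u v p ->
         D (phi u) (phi v) = \sum_(ab <- path_edges u p) len ab.1 ab.2)].

(** Both trees carry the elements of the bag as labels, with the same distances
    between them, so [tree_metric_unique] applies. *)
Lemma realizes_unique k1 F1 k1' (V1 : finType) (e1 : rel V1) phi1 len1
    k2 F2 k2' (V2 : finType) (e2 : rel V2) phi2 len2 :
  realizes k1 F1 k1' e1 phi1 len1 -> realizes k2 F2 k2' e2 phi2 len2 ->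
  exists psi : V1 -> V2, [/\ bijective psi,
    forall v, phi1 v \in belts b -> phi2 (psi v) = phi1 v,
    forall v, phi2 (psi v) \in belts b -> phi1 v \in belts b
  & forall u v, e1 u v = e2 (psi u) (psi v)].
Proof.
case=> -[T1 inj1 _] [[_ sur1 _ deg1] [len1C len1_gt0 D1]].
case=> -[T2 inj2 _] [[_ sur2 _ deg2] [len2C len2_gt0 D2]].
pose X := {x : node n | x \in belts b}.
pose mk x xb : X := exist (fun y : node n => is_true (y \in belts b)) x xb.
have /choice[lab1 lab1P] : forall x : X, exists v, phi1 v = val x.
  by move=> x; apply: sur1 (valP x).
have /choice[lab2 lab2P] : forall x : X, exists v, phi2 v = val x.
  by move=> x; apply: sur2 (valP x).
have deg1' v : (degree e1 v <= 2)%N -> exists i, lab1 i = v.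
  by move=> /deg1 vb; exists (mk _ vb); apply: inj1; rewrite lab1P.
have deg2' v : (degree e2 v <= 2)%N -> exists i, lab2 i = v.
  by move=> /deg2 vb; exists (mk _ vb); apply: inj2; rewrite lab2P.
have same i j : tdist len1 T1 (lab1 i) (lab1 j) = tdist len2 T2 (lab2 i) (lab2 j).
  have <- : D (val i) (val j) = tdist len1 T1 (lab1 i) (lab1 j).
    rewrite -(lab1P i) -(lab1P j).
    by apply: D1; rewrite ?lab1P ?spathP ?(valP i) ?(valP j).
  rewrite -(lab2P i) -(lab2P j).
  by apply: D2; rewrite ?lab2P ?spathP ?(valP i) ?(valP j).
have [psi [psiB psiL psiE]] :=
  tree_metric_unique len1C len2C len1_gt0 len2_gt0 deg1' deg2' same.
exists psi; split=> // v vb.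
  have -> : v = lab1 (mk _ vb) by apply: inj1; rewrite lab1P.
  by rewrite psiL lab1P lab2P.
have -> : v = lab1 (mk _ vb).
  apply: (bij_inj psiB); rewrite psiL; apply: inj2.
  by rewrite lab2P.
by rewrite lab1P.
Qed.
End SmallBags.

Lemma path_edges_map (S T : finType) (f : S -> T) u p :
  path_edges (f u) (map f p) = [seq (f ab.1, f ab.2) | ab <- path_edges u p].
Proof. by elim: p u => //= x p IHp u; congr (_ :: _); apply: IHp. Qed.

Section Solve.
Variables (R : realType) (V : finType) (e : rel V) (n : nat) (lab : 'I_n -> V).
Variable len : V -> V -> R.
Hypothesis treeT : is_tree e.
Hypothesis deg_lab : forall v, (degree e v <= 2)%N -> exists i, lab i = v.
Hypothesis len_sym : forall u v, len u v = len v u.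
Hypothesis len_gt0 : forall u v, e u v -> 0 < len u v.
Variables (d : 'I_n -> 'I_n -> R) (c : choices n R).
Hypothesis dE : forall i j, d i j = tdist len treeT (lab i) (lab j).

Variables (phi : V -> node n) (b : bag n R) (w : V) (U : {set V}) (k : nat).
Hypotheses (nm : names_labels lab phi) (enc : encodes lab len treeT phi b w U).
Hypothesis old : forall j, phi w = inr j -> (j < k)%N.

Let e_sym : symmetric e. Proof. by case: treeT. Qed.
Let e_irr : irreflexive e. Proof. by case: treeT. Qed.

Definition subtree : finType := {v : V | v \in w |: U}.
Definition in_subtree v (vU : v \in w |: U) : subtree :=
  exist (fun x => is_true (x \in w |: U)) v vU.

Definition sub_e : rel subtree := relpre val e.

Lemma lift_path (u : subtree) p :
  path e (val u) p -> {subset p <= w |: U} ->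
  exists2 q : seq subtree, path sub_e u q & p = map val q.
Proof.
elim: p u => [|x p IHp] u /=; first by exists [::].
case/andP=> eux epx sub; have xU : x \in w |: U by apply: sub; exact: mem_head.
have [||q eq ->] := IHp (in_subtree xU) => //.
  by move=> y yp; apply: sub; rewrite inE yp orbT.
by exists (in_subtree xU :: q) => //=; rewrite eq andbT.
Qed.

Lemma sub_tree : is_tree sub_e.
Proof.
have [_ _ _ _ acyc] := treeT; have [regU _ _ _] := enc; split.
- by apply/card_gt0P; exists (in_subtree (finset.setU11 w U)).
- by move=> u v; rewrite /sub_e /= e_sym.
- by move=> u; rewrite /sub_e /= e_irr.
- move=> u v; have sub : {subset spath treeT (val u) (val v) <= w |: U}.
    move=> x xp; apply: (region_convex regU (valP u) (valP v) (treeT := treeT)).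
    by rewrite /btw inE xp orbT.
  have [q eq qE] := lift_path (path_spath treeT (val u) (val v)) sub.
  apply/connectP; exists q => //; apply: val_inj.
  by rewrite -last_map -qE last_spath.
- move=> s /andP[es us]; rewrite -(size_map val); apply: acyc.
  apply/andP; split; last by rewrite map_inj_uniq //; exact: val_inj.
  case: s es {us} => //= x s; rewrite -map_rcons.
  by rewrite path_map.
Qed.

(** Latent vertices get names that are unused, by their rank in the subtree. *)
Definition sub_phi (v : subtree) : node n :=
  if val v \in elts lab w U then phi (val v) else inr (k + enum_rank v)%N.

Definition sub_len (u v : subtree) : R := len (val u) (val v).

Lemma inr_belts j : (inr j : node n) \in belts b -> (j < k)%N.
Proof.
case/(belts_elts nm enc)=> x xE xj.
by apply: old; rewrite -(elts_inr nm xE xj).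
Qed.

Lemma sub_phi_belts v : (sub_phi v \in belts b) = (val v \in elts lab w U).
Proof.
rewrite /sub_phi; case: ifP => vE; first exact: (elts_belts nm enc).
by apply/negP => /inr_belts; rewrite ltnNge leq_addr.
Qed.

Lemma sub_phi_inj : injective sub_phi.
Proof.
move=> u v; have := sub_phi_belts u; have := sub_phi_belts v.
rewrite /sub_phi; case: ifP => vE; case: ifP => uE vb ub.
- by move=> /(elts_inj nm uE vE)/val_inj.
- by move=> uv; rewrite -uv ub in vb.
- by move=> uv; rewrite -uv ub in vb.
- by case=> /addnI /val_inj /enum_rank_inj.
Qed.

Lemma sub_degree v : val v \in U -> degree e (val v) = degree sub_e v.
Proof.
have [[wU clU] _ _ _] := enc => vU; rewrite /degree.
rewrite -(card_imset _ val_inj); congr #|pred_of_set _|; apply/setP => u.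
rewrite !inE; apply/idP/imsetP => [evu|[x]]; last by rewrite inE => + ->.
have uU : u \in w |: U.
  rewrite !inE; have [//|uw] := eqVneq u w; exact: (clU _ _ vU evu uw).
by exists (in_subtree uU); rewrite ?inE.
Qed.

Definition sub_edges : seq (node n * node n) :=
  [seq (sub_phi uv.1, sub_phi uv.2) | uv <- enum [pred uv | sub_e uv.1 uv.2]].

(** The subtree on [w] and [U] is a solution for the bag, so the computed
    solution is one as well. *)
Lemma sub_realizes :
  realizes b (bdist d b) k sub_edges (k + #|subtree|) sub_e sub_phi sub_len.
Proof.
split; [split|split; split].
- exact: sub_tree.
- exact: sub_phi_inj.
- split=> [u v|x y /mapP[[u v] _ [-> ->]]]; last by exists u, v.
  have mem x y : ((sub_phi x, sub_phi y) \in sub_edges) = sub_e x y.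
    apply/mapP/idP => [[[x' y']]|exy]; last by exists (x, y); rewrite ?mem_enum.
    by rewrite mem_enum inE /= => exy [/sub_phi_inj -> /sub_phi_inj ->].
  by rewrite !mem /sub_e /= [e (val v) _]e_sym orbb.
- exact: leq_addr.
- move=> x /(belts_elts nm enc)[v vE <-].
  by exists (in_subtree (elts_sub vE)); rewrite /sub_phi /= vE.
- move=> v; rewrite sub_phi_belts /sub_phi => /negPf ->.
  by exists (k + enum_rank v)%N; split; rewrite // leq_addr ltn_add2l ltn_ord.
- move=> v dv; rewrite sub_phi_belts; have := valP v; rewrite /= inE.
  rewrite finset.in_set1 => /orP[/eqP ->|vU]; first exact: elts_top.
  rewrite -sub_degree // in dv; have [i iv] := deg_lab dv.
  by rewrite -iv; apply: elts_lab; rewrite iv.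
- by move=> u v; exact: len_sym.
- by move=> u v; exact: len_gt0.
- move=> u v p; rewrite !sub_phi_belts => uE vE /and3P[ep /eqP lp up].
  rewrite /sub_phi uE vE (bdistE len_sym dE nm enc) //.
  have sp : simple_path e (val u) (val v) (map val p).
    rewrite /simple_path path_map ep last_map lp eqxx /=.
    by have := map_inj_uniq val_inj (u :: p); rewrite /= => ->.
  by rewrite /tdist (spathE treeT sp) /plen path_edges_map big_map.
Qed.

(** The computed tree is isomorphic to the subtree on [w] and [U]; the names of
    the former, transported along the isomorphism, name the latter. *)
Lemma solve_resolution F k' : ch_solve c k b (bdist d b) = (F, k') ->
  exists phi', resolution lab len treeT w U k phi [::] F k' phi' finset.set0.
Proof.
move=> FE; have [regU pw bE _] := enc; have [wU clU] := regU.
have : tree_on k b (bdist d b) sub_edges (k + #|subtree|).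
  by exists subtree, sub_e, sub_phi, sub_len; exact: sub_realizes.
move=> /(ch_solveP c); rewrite FE /= => -[V2 [e2 [phi2 [len2 real2]]]].
have [psi [psiB psi_bel psi_lat psiE]] := realizes_unique sub_realizes real2.
case: real2 => -[_ inj2 [edge2 range2]] [[lek _ lat2 _] _].
pose phi' v := if insub v is Some x then phi2 (psi (x : subtree)) else phi v.
pose phi1 v := if v \in U then phi' v else phi v.
have phiU (x : subtree) : phi1 (val x) = phi2 (psi x).
  rewrite /phi1 /phi'; case: ifP => xU; first by rewrite valK.
  have /eqP xw : val x == w.
    by have := valP x; rewrite /= finset.in_setU xU orbF finset.in_set1.
  have xE : val x \in elts lab w U by rewrite xw elts_top.
  by rewrite psi_bel ?sub_phi_belts // /sub_phi xE.
have toU v : v \in w |: U -> exists x : subtree, val x = v.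
  by move=> vU; exists (in_subtree vU).
have phi_elt (x : subtree) : val x \in elts lab w U -> phi1 (val x) = phi (val x).
  by move=> xE; rewrite phiU psi_bel ?sub_phi_belts // /sub_phi xE.
have phi_lat (x : subtree) : val x \notin elts lab w U ->
    exists2 j, phi1 (val x) = inr j & (k <= j < k')%N.
  move=> xE; have /lat2[j [jE jk]] : phi2 (psi x) \notin belts b.
    by apply: contra xE => /psi_lat; rewrite sub_phi_belts.
  by exists j; rewrite ?phiU.
have inA v : v \in w |: (U :\: finset.set0) -> exists x : subtree, val x = v.
  by rewrite finset.setD0; exact: toU.
exists phi1; split=> //.
- exact: finset.sub0set.
- move=> v i; case: (boolP (v \in w |: U)) => [/toU[x <-]|vU]; last first.
    by move: vU; rewrite /phi1 !inE negb_or => /andP[_ /negPf ->].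
  case: (boolP (val x \in elts lab w U)) => [/phi_elt ->//|xE].
  have [j -> _] := phi_lat _ xE; split=> // xi.
  have := valP x; rewrite /= finset.in_setU finset.in_set1 => /orP[xw|xU].
    by move: xE; rewrite [val x](eqP xw) elts_top.
  by move: xE; rewrite [val x]xi elts_lab -?xi.
- by move=> v; rewrite finset.setD0 /phi1 => /negPf ->.
- split=> // v j; rewrite finset.setD0 => vU.
  have /toU[x xv] : v \in w |: U by rewrite inE vU orbT.
  rewrite -xv in vU *; case: (boolP (val x \in elts lab w U)) => [xE|xE].
    by rewrite phi_elt // => /(elts_inr nm xE) xw; rewrite xw (negPf wU) in vU.
  by have [j' -> jk] := phi_lat _ xE; case=> <-.
- move=> u v; rewrite finset.setD0 => uU vU.
  have /toU[x <-] : u \in w |: U by rewrite inE uU orbT.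
  have /toU[y <-] : v \in w |: U by rewrite inE vU orbT.
  by rewrite !phiU => /inj2/(bij_inj psiB) ->.
- move=> x y xyF; have [u2 [v2 [xE yE]]] := range2 _ _ xyF.
  have [psi' _ K] := psiB; exists (val (psi' u2)), (val (psi' v2)).
  rewrite finset.setD0 (valP (psi' u2)) (valP (psi' v2)) !phiU !K; split=> //.
  by move: (psiE (psi' u2) (psi' v2)); rewrite /sub_e /= !K edge2 -xE -yE xyF.
- move=> u v; rewrite finset.setD0 => uU /toU[y <-].
  have /toU[x <-] : u \in w |: U by rewrite inE uU orbT.
  by rewrite !phiU -edge2 -psiE.
Qed.
End Solve.

(** * BASIC *)

Section Basic.
Variables (R : realType) (V : finType) (e : rel V) (n : nat) (lab : 'I_n -> V).
Variable len : V -> V -> R.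
Hypothesis treeT : is_tree e.
Hypothesis deg_lab : forall v, (degree e v <= 2)%N -> exists i, lab i = v.
Hypothesis len_sym : forall u v, len u v = len v u.
Hypothesis len_gt0 : forall u v, e u v -> 0 < len u v.
Variables (d : 'I_n -> 'I_n -> R) (c : choices n R).
Hypothesis dE : forall i j, d i j = tdist len treeT (lab i) (lab j).

Variables (phi : V -> node n) (b : bag n R) (w : V) (U : {set V}) (k : nat).
Hypotheses (nm : names_labels lab phi) (enc : encodes lab len treeT phi b w U).
Hypothesis old : forall j, phi w = inr j -> (j < k)%N.
Variable a : 'I_n.
Hypothesis ab : a \in bothers b.

Notation btw := (btw treeT).
Notation dist := (tdist len treeT).
Notation elts := (elts lab w U).
Notation A := (lab a).
Notation hangs := (hangs treeT w A).
Notation hanging := (hanging treeT w A U).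

Let e_sym : symmetric e. Proof. by case: treeT. Qed.
Let distC u v : dist u v = dist v u. Proof. exact: tdistC. Qed.
Let regU : region e w U. Proof. by case: enc. Qed.
Let wU : w \notin U. Proof. by case: regU. Qed.
Let AU : A \in U. Proof. by case: enc ab => _ _ ->; rewrite inE. Qed.
Let elt_w : w \in elts. Proof. exact: elts_top. Qed.
Let elt_A : A \in elts. Proof. exact: elts_lab. Qed.
Let phiA : phi A = inl a. Proof. exact: (names_lab nm). Qed.
Let phiw : phi w = brep b. Proof. by case: enc. Qed.

(** The path is listed from [A] to [w] because BASIC sorts its bags by
    increasing offset. *)
Definition trunk : seq V := rev (w :: spath treeT w A).

Lemma mem_trunk x : (x \in trunk) = btw w x A.
Proof. by rewrite mem_rev. Qed.

Lemma trunk_uniq : uniq trunk.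
Proof. by rewrite rev_uniq uniq_spath. Qed.

Lemma trunk_sub x : btw w x A -> x \in w |: U.
Proof.
by move=> wxA; apply: (region_convex regU _ _ wxA); rewrite !inE ?eqxx ?AU ?orbT.
Qed.

Definition offset v : R := dist v A - dist v w.

(** If [x] is the projection of [v] to the trunk, then [offset v] is the offset
    [dist w A - 2 * dist w x] of [x], which determines [x]. So the classes of
    BASIC are the sets of elements with a common projection. *)
Lemma offsetE x v : btw w x A -> (offset v == offset x) = hangs x v.
Proof.
have hang_offset y : hangs y v -> offset v = offset y.
  case/andP=> /(tdist_btw len) dw /(tdist_btw len) dA.
  rewrite /offset [dist v A]distC dA [dist v w]distC dw.
  rewrite [dist A y]distC [dist w y]distC; lra.
move=> wxA; apply/eqP/idP => [fvx|/hang_offset //].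
have [y wyA hy] := hangs_ex treeT w A v.
suff -> : x = y by [].
apply: (btw_eq_dist len_gt0 wxA wyA).
have := hang_offset _ hy; rewrite fvx /offset.
move: (tdist_btw len wxA) (tdist_btw len wyA).
rewrite [dist x w]distC [dist y w]distC; lra.
Qed.

Lemma spath_sorted v : sorted (fun x y => dist w x < dist w y) (w :: spath treeT w v).
Proof.
move: (spathP treeT w v); move: (spath treeT w v) => p.
elim/last_ind: p v => // p y IHp v /and3P[].
rewrite rcons_path last_rcons -rcons_cons rcons_uniq => /andP[ep ey] /eqP yv.
case/andP=> yp up; rewrite [sorted _ _]/= rcons_path; apply/andP; split.
  by apply: (IHp (last w p)); rewrite /simple_path ep eqxx up.
have sy : spath treeT w y = rcons p y.
  by apply: spathE; rewrite /simple_path rcons_path ep ey last_rcons eqxx -rcons_cons rcons_uniq yp.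
have bt : btw w (last w p) y by rewrite /btw sy -rcons_cons mem_rcons inE mem_last orbT.
rewrite [X in _ < X](tdist_btw len bt) ltrDl (tdist_gt0 treeT len_gt0) //.
by apply: contraNneq yp => <-; exact: mem_last.
Qed.

Lemma trunk_sorted : sorted <%R [seq offset x | x <- trunk].
Proof.
rewrite sorted_map /trunk rev_sorted.
have sub : {in [pred x | btw w x A] &,
    subrel (fun x y => dist w x < dist w y) (fun x y => offset y < offset x)}.
  move=> x y /(tdist_btw len) dx /(tdist_btw len) dy /=.
  rewrite /offset [dist x w]distC [dist y w]distC; lra.
apply: (sub_in_sorted sub) (spath_sorted A).
by apply/allP.
Qed.

(** A latent vertex of the trunk has a third branch, which meets the bag; hence
    BASIC does not miss a vertex of the trunk. *)
Lemma hangs_elt x : btw w x A -> exists2 y, y \in elts & hangs x y.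
Proof.
move=> wxA; have [xE|xE] := boolP (x \in elts).
  by exists x; rewrite ?hangs_self.
have xw : x != w by apply: contraNneq xE => ->.
have xU : x \in U.
  by have := trunk_sub wxA; rewrite finset.in_setU finset.in_set1 (negPf xw).
have dx : (2 < degree e x)%N.
  rewrite ltnNge; apply/negP => /deg_lab[i ix].
  by rewrite -ix elts_lab ?ix in xE.
have [i [wxi Axi]] := third_label treeT deg_lab w A dx.
exists (lab i); last by rewrite /hangs wxi Axi.
apply: elts_lab; apply: contraT => iU.
have := region_sep treeT regU xU iU => xwi.
by rewrite (btw_anti xwi wxi) eqxx in xw.
Qed.

Let D (x : node n) := bdist d b x (inl a) - bdist d b x (brep b).

Lemma bag_offset x : x \in elts -> D (phi x) = offset x.
Proof.
by move=> xE; rewrite /D -phiA -phiw !(bdistE len_sym dE nm enc).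
Qed.

Lemma basic_vals :
  sort <=%R (undup [seq D v | v <- belts b]) = [seq offset x | x <- trunk].
Proof.
apply: (irr_sorted_eq (leT := <%R)).
- exact: lt_trans.
- exact: ltxx.
- by rewrite lt_sorted_uniq_le sort_uniq undup_uniq sort_sorted //; exact: le_total.
- exact: trunk_sorted.
move=> t; rewrite mem_sort mem_undup; apply/mapP/mapP => [[v vb ->]|[x xt ->]].
  have [y yE <-] := belts_elts nm enc vb; rewrite bag_offset //.
  have [x wxA hx] := hangs_ex treeT w A y; exists x; first by rewrite mem_trunk.
  by apply/eqP; rewrite offsetE.
rewrite mem_trunk in xt; have [y yE hy] := hangs_elt xt.
exists (phi y); first exact: (elts_belts nm enc).
by rewrite bag_offset //; apply/esym/eqP; rewrite offsetE.
Qed.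

Definition off_trunk : {set V} := [set v in U | ~~ btw w v A].

(** The vertices of the trunk that are not elements of the bag are the new
    latent nodes; the index in [trunk] is the index of the bag. *)
Definition basic_names v : node n :=
  if btw w v A && (v \notin elts) then inr (k + index v trunk)%N else phi v.

Lemma basic_names_elt x : x \in elts -> basic_names x = phi x.
Proof. by rewrite /basic_names => ->; rewrite andbF. Qed.

Lemma basic_names_new x : btw w x A -> x \notin elts ->
  basic_names x = inr (k + index x trunk)%N.
Proof. by rewrite /basic_names => -> ->. Qed.

Lemma new_not_lab x i : btw w x A -> x \notin elts -> x <> lab i.
Proof.
move=> wxA xE xi; have := trunk_sub wxA; rewrite xi finset.in_setU finset.in_set1.
case/orP=> [/eqP iw|iU]; first by rewrite xi iw elt_w in xE.
by rewrite xi elts_lab in xE.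
Qed.

Lemma basic_names_labels : names_labels lab basic_names.
Proof.
move=> v i; rewrite /basic_names; case: ifP => [/andP[wvA vE]|_]; last exact: nm.
by split=> // vi; case: (new_not_lab wvA vE vi).
Qed.

Lemma hanging_lab x i : x != lab i -> hangs x (lab i) -> lab i \in w |: U ->
  lab i \in hanging x.
Proof.
move=> xi hx; rewrite !inE [lab i == x]eq_sym xi hx andbT /= => /orP[/eqP iw|->//].
by move: hx; rewrite /hangs iw btw_id => /andP[]; rewrite -iw (negPf xi).
Qed.

(** Every element [y] of the class of [x] satisfies
    [dist y A = dist y x + dist x A]. So the minimizer is [x] if [x] is an
    element of the bag; otherwise the minimizer is not on the trunk and the test
    of BASIC fails. *)
Lemma basic_bag_encodes x j : btw w x A -> j = (k + index x trunk)%N ->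
  encodes lab len treeT basic_names (basic_bag d c b a j (offset x)) x (hanging x).
Proof.
move=> wxA jE; rewrite /basic_bag; cbv zeta.
set Bi := seq.filter _ _; set u := ch_argmin _ _ _.
have BiP v : reflect (exists2 y, y \in elts /\ hangs x y & phi y = v) (v \in Bi).
  rewrite mem_filter; apply: (iffP andP) => [[/eqP Dv vb]|[y [yE hy] <-]].
    have [y yE yv] := belts_elts nm enc vb; exists y => //; split=> //.
    by rewrite -offsetE // -bag_offset // yv; apply/eqP.
  split; last exact: (elts_belts nm enc).
  by rewrite -/(D _) bag_offset // offsetE.
have [y0 y0E hy0] := hangs_elt wxA.
have Bin0 : Bi != [::].
  apply/negP => /eqP Bi0; have : phi y0 \in Bi by apply/BiP; exists y0.
  by rewrite Bi0.
have [/BiP[y [yE hy] yu] umin] :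
    u \in Bi /\ forall v, v \in Bi -> bdist d b u (inl a) <= bdist d b v (inl a).
  by have [? ?] := ch_argminP c (fun v => bdist d b v (inl a)) Bin0.
have labBi i : (inl i \in Bi) = (lab i \in elts) && hangs x (lab i).
  apply/BiP/andP => [[z [zE hz] /nm zi]|[iE hi]]; first by rewrite -zi.
  by exists (lab i); rewrite ?(names_lab nm).
have bE i : (i \in bothers b) = (lab i \in U) by case: enc => _ _ -> _; rewrite inE.
have eltU i : lab i \in elts -> lab i \in w |: U by exact: elts_sub.
rewrite -yu -phiw -phiA !(bdistE len_sym dE nm enc) //.
rewrite eq_sym -(btwE treeT len_sym len_gt0); case: ifPn => [wyA|wyA].
- have xy : x = y by exact: (hangs_uniq wxA wyA hy (hangs_self _ _ _ _)).
  rewrite -xy in yE yu *; split=> /=.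
  + exact: (region_hanging regU AU wxA).
  + exact: basic_names_elt.
  + apply/setP => i; rewrite finset.in_set finset.in_set labBi.
    apply/andP/idP => [[/andP[iE hi] ix]|].
      apply: hanging_lab (eltU _ iE) => //.
      by apply: contraNneq ix => ->; rewrite (names_lab nm).
    rewrite inE => /and3P[iU ix hi]; rewrite elts_lab // hi; split=> //.
    by apply: contraNneq ix => /esym/nm ->.
  + move=> j' i xj'; have xw := elts_inr nm yE xj'.
    rewrite finset.in_set labBi => /andP[/andP[iE hi] ix].
    case: enc => _ _ _ rE; rewrite xw; apply: (rE j'); first by rewrite -phiw -xw.
    rewrite bE; move: (eltU _ iE); rewrite finset.in_setU finset.in_set1 => /orP[/eqP iw|//].
    by rewrite -(names_lab nm) iw xw eqxx in ix.
- have xE : x \notin elts.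
    apply/negP => xE; have /umin : phi x \in Bi.
      by apply/BiP; exists x; rewrite ?hangs_self.
    rewrite -yu -phiA !(bdistE len_sym dE nm enc) //.
    move: hy => /andP[_ /(tdist_btw len)]; rewrite distC => ->.
    rewrite [dist A x]distC gerDl leNgt => /negP; apply.
    apply: (tdist_gt0 treeT len_gt0).
    by apply: contraNneq wyA => <-.
  have xlab i : x != lab i by apply/eqP; exact: new_not_lab.
  split=> /=.
  + exact: (region_hanging regU AU wxA).
  + by rewrite basic_names_new // jE.
  + apply/setP => i; rewrite finset.in_set finset.in_set labBi.
    apply/andP/idP => [[iE hi]|]; first exact: (hanging_lab _ _ (eltU _ iE)).
    by rewrite inE => /and3P[iU _ hi]; rewrite elts_lab.
  + move=> j' i _; rewrite finset.in_set labBi => /andP[iE hi].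
    transitivity ((bdist d b (inl i) (phi A) + bdist d b (inl i) (phi w)
                   - dist A w) / 2); first by [].
    rewrite -(names_lab nm) !(bdistE len_sym dE nm enc) //.
    move: (tdist_btw len wxA); move: hi => /andP[/(tdist_btw len) + /(tdist_btw len)].
    rewrite [dist (lab i) A]distC [dist (lab i) w]distC [dist (lab i) x]distC.
    rewrite [dist A x]distC [dist A w]distC => -> -> ->.
    lra.
Qed.

Lemma mem_on_trunk v : (v \in U :\: off_trunk) = (v \in U) && btw w v A.
Proof. by rewrite !inE; case: (v \in U); rewrite //= negbK ?andbT. Qed.

Lemma mem_trunk_set v : (v \in w |: (U :\: off_trunk)) = btw w v A.
Proof.
rewrite finset.in_setU finset.in_set1 mem_on_trunk; apply/idP/idP => [/orP[/eqP ->|/andP[]//]|wvA].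
  exact: btw_l.
by have := trunk_sub wvA; rewrite wvA andbT finset.in_setU finset.in_set1.
Qed.

Lemma nth_trunk i : (i < size trunk)%N -> btw w (nth w trunk i) A.
Proof. by move=> lti; rewrite -mem_trunk mem_nth. Qed.

Lemma nth_bag_encodes i : (i < size trunk)%N ->
  encodes lab len treeT basic_names
    (basic_bag d c b a (k + i) (nth 0 [seq offset x | x <- trunk] i))
    (nth w trunk i) (hanging (nth w trunk i)).
Proof.
move=> lti; rewrite (nth_map w) //; apply: basic_bag_encodes; first exact: nth_trunk.
by rewrite index_uniq // trunk_uniq.
Qed.

Lemma basic_inj : {in U :\: off_trunk &, injective basic_names}.
Proof.
have old_elt x j : x \in U -> x \in elts -> phi x <> inr j.
  by move=> xU xE /(elts_inr nm xE) xw; rewrite xw (negPf wU) in xU.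
move=> u v; rewrite !mem_on_trunk => /andP[uU ut] /andP[vU vt].
have [uE|uE] := boolP (u \in elts); have [vE|vE] := boolP (v \in elts).
- by rewrite !basic_names_elt //; exact: (elts_inj nm uE vE).
- by rewrite basic_names_elt // basic_names_new // => /(old_elt _ _ uU uE).
- by rewrite basic_names_new // basic_names_elt // => /esym/(old_elt _ _ vU vE).
rewrite !basic_names_new // => -[] /addnI uv.
by rewrite -(nth_index w (_ : u \in trunk)) ?mem_trunk // uv nth_index ?mem_trunk.
Qed.

Lemma basic_covers :
  covers lab len treeT basic_names (w |: (U :\: off_trunk))
    [seq basic_bag d c b a (k + i) (nth 0 [seq offset x | x <- trunk] i)
       | i <- iota 0 (size trunk)] off_trunk.
Proof.
apply: (covers_map (w := nth w trunk) (reg := fun i => hanging (nth w trunk i))).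
- exact: iota_uniq.
- move=> i; rewrite mem_iota => /andP[_ lti]; split.
  + exact: nth_bag_encodes.
  + by rewrite mem_trunk_set nth_trunk.
  + apply/fintype.subsetP => v; rewrite !inE => /and3P[-> vx hv] /=.
    apply: contra vx => wvA; apply/eqP.
    exact: (hangs_uniq wvA (nth_trunk lti) (hangs_self _ _ _ _) hv).
- move=> v; rewrite !inE => /andP[vU nwvA].
  have [x wxA hx] := hangs_ex treeT w A v.
  have xt : x \in trunk by rewrite mem_trunk.
  exists (index x trunk); first by rewrite mem_iota index_mem.
  rewrite nth_index // !inE vU hx andbT /=.
  by apply: contraNneq nwvA => ->.
- move=> i j v; rewrite !mem_iota !inE => /andP[_ lti] /andP[_ ltj].
  case/and3P=> _ _ hi /and3P[_ _ hj].
  have := hangs_uniq (nth_trunk lti) (nth_trunk ltj) hi hj.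
  by move/eqP; rewrite nth_uniq ?trunk_uniq // => /eqP.
Qed.

Lemma basic_resolution :
  resolution lab len treeT w U k phi (basic d c k b a).1.1 (basic d c k b a).1.2
    (basic d c k b a).2 basic_names off_trunk.
Proof.
have -> : basic d c k b a =
    ([seq basic_bag d c b a (k + i) (nth 0 [seq offset x | x <- trunk] i)
       | i <- iota 0 (size trunk)],
     zip (map basic_names trunk) (behead (map basic_names trunk)),
     (k + size trunk)%N).
  rewrite /basic; cbv zeta; rewrite basic_vals size_map.
  set bags := map _ (iota _ _).
  suff -> : [seq brep b0 | b0 <- bags] = map basic_names trunk by [].
  rewrite -[trunk in RHS](mkseq_nth w) /mkseq -!map_comp.
  apply/eq_in_map => i; rewrite mem_iota /= => lti.
  by case: (nth_bag_encodes lti).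
have consecutive u v : e u v -> btw w u A -> btw w v A ->
    ((basic_names u, basic_names v) \in zip (map basic_names trunk) (behead (map basic_names trunk)))
    || ((basic_names v, basic_names u) \in zip (map basic_names trunk) (behead (map basic_names trunk))).
  wlog wuv : u v / btw w u v => [IH|] euv wuA wvA.
    case: (btw_total wuA wvA) => [wuv|wvu]; first exact: IH.
    by rewrite orbC; apply: IH; rewrite // e_sym.
  have [s1 [s2 sE]] := spath_adjacent euv wuA wvA wuv.
  apply/orP; right; apply/mem_zip_behead.
  exists (map basic_names (rev s2)), (map basic_names (rev s1)).
  by rewrite /trunk sE rev_cat map_cat !rev_cons !map_rcons -!cats1 -!catA.
split=> //=.
- by apply/fintype.subsetP => v; rewrite inE => /andP[].
- exact: basic_names_labels.
- move=> v; rewrite mem_on_trunk /basic_names; case: ifP => // /andP[wvA vE].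
  have := trunk_sub wvA; rewrite finset.in_setU finset.in_set1 wvA andbT.
  by case/orP=> [/eqP vw|-> //]; rewrite vw elt_w in vE.
- split; first exact: leq_addr.
  move=> v j; rewrite mem_on_trunk => /andP[vU wvA]; have [vE|vE] := boolP (v \in elts).
    by rewrite basic_names_elt // => /(elts_inr nm vE) vw; rewrite vw (negPf wU) in vU.
  by rewrite basic_names_new // => -[<-]; rewrite leq_addr ltn_add2l index_mem mem_trunk.
- exact: basic_inj.
- exact: basic_covers.
- move=> x y /mem_zip_behead[s1 [s2 sE]].
  have lti : ((size s1).+1 < size trunk)%N.
    by rewrite -(size_map basic_names) sE size_cat /= !addnS !ltnS leq_addr.
  have nthE i : (i < size trunk)%N ->
      basic_names (nth w trunk i) = nth x (s1 ++ x :: y :: s2) i.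
    by move=> ?; rewrite -sE (nth_map w).
  exists (nth w trunk (size s1)), (nth w trunk (size s1).+1).
  rewrite !mem_trunk_set !nth_trunk ?(ltnW lti) // !nthE ?(ltnW lti) //.
  rewrite !nth_cat ltnn subnn ltnNge leqnSn subSnn /=; split=> //.
  have /(sortedP w) : sorted e trunk.
    rewrite /trunk rev_sorted (eq_sorted (e' := e)) => [|? ?]; last by rewrite e_sym.
    exact: path_spath.
  by apply.
- move=> u v; rewrite mem_on_trunk mem_trunk_set => /andP[_ wuA] wvA euv.
  exact: consecutive.
Qed.

End Basic.

(** * Passes, runs and the returned skeleton *)

Section Pass.
Variables (R : realType) (V : finType) (e : rel V) (n : nat) (lab : 'I_n -> V).
Variable len : V -> V -> R.
Hypothesis treeT : is_tree e.
Hypothesis deg_lab : forall v, (degree e v <= 2)%N -> exists i, lab i = v.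
Hypothesis len_sym : forall u v, len u v = len v u.
Hypothesis len_gt0 : forall u v, e u v -> 0 < len u v.
Variables (d : 'I_n -> 'I_n -> R) (c : choices n R).
Hypothesis dE : forall i j, d i j = tdist len treeT (lab i) (lab j).

Notation bag := (bag n R).
Notation resolution := (resolution lab len treeT).
Notation encodes := (encodes lab len treeT).
Notation covers := (covers lab len treeT).
Notation names_labels := (names_labels lab).

Lemma refineP k (Bs : seq bag) u :
  (refine d c k Bs u = (Bs, [::], k) /\
     (has (fun b => brep b == inl u) Bs \/ all (fun b => u \notin bothers b) Bs)) \/
  exists bs1 b bs2, [/\ Bs = bs1 ++ b :: bs2, u \in bothers b &
    refine d c k Bs u = (bs1 ++ (basic d c k b u).1.1 ++ bs2,
                         (basic d c k b u).1.2, (basic d c k b u).2)].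
Proof.
elim: Bs => [|b Bs IH]; first by left; split=> //; right.
have -> : refine d c k (b :: Bs) u =
    if brep b == inl u then (b :: Bs, [::], k) else
    if u \in bothers b then
      ((basic d c k b u).1.1 ++ Bs, (basic d c k b u).1.2, (basic d c k b u).2)
    else (b :: (refine d c k Bs u).1.1, (refine d c k Bs u).1.2, (refine d c k Bs u).2).
  rewrite /=; case: ifP => // _; case: ifP => // _.
  by case: (refine d c k Bs u) => [[]].
case: ifP => [repu|_]; first by left; split=> //; left; rewrite /= repu.
case: ifPn => [ub|ub]; first by right; exists [::], b, Bs.
case: IH => [[-> IH]|[bs1 [b' [bs2 [-> ub' ->]]]]]; last by right; exists (b :: bs1), b', bs2.
by left; split=> //=; case: IH => ->; [left; rewrite orbT|right; rewrite ub].
Qed.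

Lemma covers_has phi (A U : {set V}) bs u :
  covers phi A bs U -> lab u \in U -> has (fun b => u \in bothers b) bs.
Proof.
elim: bs U => [|b bs IH] U /=; first by move=> ->; rewrite inE.
case=> w [U1 [[_ _ -> _] _ _ cov]] uU; rewrite inE.
have [//|uU1] := boolP (lab u \in U1).
by rewrite (IH _ cov) ?orbT // inE uU1.
Qed.

Lemma covers_rep phi (A U : {set V}) bs u :
  names_labels phi -> covers phi A bs U ->
  has (fun b => brep b == inl u) bs -> lab u \in A.
Proof.
move=> nm; elim: bs U => //= b bs IH U [w [U1 [[_ pw _ _] wA _ cov]]].
case/orP=> [|/IH]; last by apply; exact: cov.
by rewrite -pw => /eqP/nm <-.
Qed.

Section Refine.
Variables (w : V) (U1 : {set V}) (k0 : nat) (phi0 : V -> node n).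

(** A sampled node is never in a remaining region: BASIC places the whole trunk,
    whose end is that node. *)
Lemma refine_resolution Bs E k phi (U : {set V}) u :
  resolution w U1 k0 phi0 Bs E k phi U ->
  exists phi' (U' : {set V}),
    [/\ resolution w U1 k0 phi0 (refine d c k Bs u).1.1
          (E ++ (refine d c k Bs u).1.2) (refine d c k Bs u).2 phi' U',
        U' \subset U & lab u \notin U'].
Proof.
move=> res.
have [[-> unused]|[bs1 [b [bs2 [BsE ub ->]]]]] := refineP k Bs u.
  exists phi, U; rewrite /= cats0; split=> //.
  have [wU1 _ sU nm _ _ _ cov _ _] := res.
  case: unused => [/(covers_rep nm cov)|none].
    rewrite !inE => /orP[/eqP ->|/andP[]//].
    by apply: contra wU1; apply: fintype.subsetP.
  have noneC : ~~ has (fun b => u \in bothers b) Bs by rewrite -all_predC.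
  exact: contra (covers_has cov) noneC.
rewrite BsE in res; have {}res := resolutionC (bs1 := bs1) (bs2 := b :: bs2) res.
have [w' [U' [enc sU' w'U old glue]]] := resolution_comp res.
have nm := res_names res.
have basicR := basic_resolution deg_lab len_sym len_gt0 c dE nm enc old ub.
have res' := glue _ _ _ _ _ basicR; rewrite catA in res'.
do 2 eexists; split; first exact: resolutionC res'.
  rewrite finset.subUset finset.subsetDl /=; apply: fintype.subset_trans sU'.
  exact: res_sub basicR.
have uU' : lab u \in U' by case: enc ub => _ _ -> _; rewrite inE.
by rewrite !inE uU' /= btw_r.
Qed.

Lemma refine_all_resolution us Bs E k phi (U : {set V}) :
  resolution w U1 k0 phi0 Bs E k phi U ->
  exists phi' (U' : {set V}),
    [/\ resolution w U1 k0 phi0 (refine_all d c k Bs E us).1.1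
          (refine_all d c k Bs E us).1.2 (refine_all d c k Bs E us).2 phi' U',
        U' \subset U & forall u, u \in us -> lab u \notin U'].
Proof.
elim: us Bs E k phi U => [|u us IH] Bs E k phi U res /=; first by exists phi, U.
have [phi1 [U2 [res1 s2 uU2]]] := refine_resolution u res.
case: (refine d c k Bs u) res1 => [[Bs' E'] k'] /= /IH[phi' [U' [res' s' us']]].
exists phi', U'; split=> //; first exact: fintype.subset_trans s2.
move=> v; rewrite inE => /orP[/eqP ->|/us'//].
by apply: contra uU2; apply: fintype.subsetP.
Qed.
End Refine.

Lemma split_pass_resolution phi b w (U : {set V}) k us C E k' :
  names_labels phi -> encodes phi b w U -> (forall j, phi w = inr j -> (j < k)%N) ->
  split_pass d c k b us = (C, E, k') ->
  exists phi' (U' : {set V}),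
    [/\ resolution w U k phi C E k' phi' U',
        forall u, u \in us -> lab u \notin U'
      & all (fun b => (bothers b != finset.set0) && is_branch lab treeT w (bothers b)) C].
Proof.
move=> nm enc old; rewrite /split_pass.
have [phi' [U' [res _ usU']]] := refine_all_resolution us (resolution_refl nm enc old).
case: (refine_all d c k [:: b] [::] us) res => [[Bs E'] k''] /= res [<- <- <-].
exists phi', U'; case: res => wU old' sU nm' keep fresh inj cov snd cpl.
have wU' : w \notin U' by apply: contra wU; apply: fintype.subsetP.
have [cov' brC] := explode_covers deg_lab len_sym len_gt0 c dE nm' wU' cov.
by split.
Qed.

End Pass.

Section Run.
Variables (R : realType) (V : finType) (e : rel V) (n : nat) (lab : 'I_n -> V).
Variable len : V -> V -> R.
Hypothesis treeT : is_tree e.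
Hypothesis lab_inj : injective lab.
Hypothesis deg_lab : forall v, (degree e v <= 2)%N -> exists i, lab i = v.
Hypothesis len_sym : forall u v, len u v = len v u.
Hypothesis len_gt0 : forall u v, e u v -> 0 < len u v.
Variables (d : 'I_n -> 'I_n -> R) (c : choices n R).
Hypothesis dE : forall i j, d i j = tdist len treeT (lab i) (lab j).

Notation bag := (bag n R).
Notation state := (state n R).
Notation resolution := (resolution lab len treeT).
Notation encodes := (encodes lab len treeT).
Notation covers := (covers lab len treeT).
Notation names_labels := (names_labels lab).
Notation root := (lab (ch_root c)).

(** At the start no latent vertex is named; the value there is arbitrary. *)
Definition start_names (v : V) : node n :=
  if [pick i | lab i == v] is Some i then inl i else inr 0%N.

Lemma start_names_labels : names_labels start_names.
Proof.
move=> v i; rewrite /start_names; case: pickP => [j /eqP <-|nov].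
  by split=> [[->]//|/lab_inj ->].
by split=> // vi; have := nov i; rewrite vi eqxx.
Qed.

Definition partial_run (st : state) phi (U : {set V}) : Prop :=
  resolution root [set~ root] 0 start_names (queue st) (skel st) (fresh st) phi U.

Lemma partial_run_init : partial_run (tree_init c) start_names [set~ root].
Proof.
have nm := start_names_labels; apply: (resolution_refl nm).
  split=> //=.
  - split=> [|u v]; rewrite !inE ?eqxx //.
  - by apply/nm.
  - by apply/setP => i; rewrite !inE inj_eq.
by move=> j; have /nm -> : root = lab (ch_root c) by [].
Qed.

Lemma partial_run_small B Q (st : state) phi U :
  queue st = B :: Q -> partial_run st phi U ->
  exists phi' U', partial_run (small_step d c B Q st) phi' U'.
Proof.
move=> qE; rewrite /partial_run qE => res.
have [w' [U' [enc sU' w'U old glue]]] := resolution_comp res.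
rewrite /small_step; case FE : (ch_solve _ _ _ _) => [F k'].
have [phi' solR] := solve_resolution deg_lab len_sym len_gt0 dE (res_names res) enc old FE.
by do 2 eexists; exact: glue solR.
Qed.

Lemma partial_run_big B Q (st : state) phi (U : {set V}) us C E k' :
  queue st = B :: Q -> partial_run st phi U ->
  split_pass d c (fresh st) B us = (C, E, k') ->
  exists phi' U', partial_run (State (Q ++ C) (skel st ++ E) k') phi' U'.
Proof.
move=> qE; rewrite /partial_run qE => res passE.
have [w' [U' [enc sU' w'U old glue]]] := resolution_comp res.
have [phi' [U'' [passR _ _]]] :=
  split_pass_resolution deg_lab len_sym len_gt0 dE (res_names res) enc old passE.
by do 2 eexists; apply: resolutionC; exact: glue passR.
Qed.

Lemma In_map (S T : Type) (f : S -> T) s y :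
  List.In y [seq f x | x <- s] -> exists x, y = f x.
Proof. by elim: s => //= x s IH [<-|/IH//]; exists x. Qed.

Lemma partial_run_reachable Delta st :
  reachable d c Delta st -> exists phi U, partial_run st phi U.
Proof.
elim=> [|{}st st' _ [phi [U run]]]; first by do 2 eexists; exact: partial_run_init.
rewrite /successors; case qE : (queue st) => [|B Q] //.
case: ifP => _ /=; first by case=> // <-; apply: partial_run_small run.
move=> /(@In_map _ _ _ _ _)[us ->]; rewrite /big_step.
case passE : (split_pass _ _ _ _ _) => [[C E] k'].
case: ifP => _; last by exists phi, U.
exact: (partial_run_big qE run passE).
Qed.

(** With no bag left every vertex has its final name, and the skeleton is the
    image of all edges. *)
Lemma finished_recovers (st : state) phi U :
  queue st = [::] -> partial_run st phi U -> recovers e lab (skel st).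
Proof.
move=> qE; rewrite /partial_run qE => -[_ _ _ nm _ _ inj /= U0 snd cpl].
rewrite U0 finset.setD0 in inj snd cpl.
have e_sym : symmetric e by case: treeT.
have allA v : v \in root |: [set~ root] by rewrite finset.setUCr inE.
have inj' : injective phi.
  move=> u v; have [->|ur] := eqVneq u root; have [->|vr] := eqVneq v root => //.
  - by move=> E; apply/esym/nm; rewrite -E; apply/nm.
  - by move=> E; apply/nm; rewrite E; apply/nm.
  - by apply: inj; rewrite !inE.
exists phi; split=> //; first by move=> i; apply/nm.
split=> [u v|x y /snd[u [v [_ _ _ -> ->]]]]; last by exists u, v.
apply/idP/orP => [euv|].
  have [ur|ur] := eqVneq u root; last first.
    by apply/orP; apply: cpl; rewrite ?allA // !inE.
  apply/orP; rewrite orbC; apply: cpl; rewrite ?allA // ?inE; last by rewrite e_sym.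
  by apply: contraTneq euv => ->; rewrite ur; case: treeT => _ _ ->.
have back x y : (phi x, phi y) \in skel st -> e x y.
  by case/snd=> x' [y' [_ _ exy /inj' -> /inj' ->]].
by case=> /back //; rewrite e_sym.
Qed.

Theorem tree_returns_recovers Delta S : tree_returns d c Delta S -> recovers e lab S.
Proof.
case=> st [/partial_run_reachable[phi [U run]] qE <-].
exact: finished_recovers run.
Qed.

End Run.

(** * Hitting sets and limits of halting probabilities *)

(** Take a member [A] of least cardinality and one of its points. By laminarity
    this point lies in every member that meets [A]; the others live in
    [G :\: A], where the argument is repeated. Each chosen point uses up at
    least [m] elements of [G]. *)
Lemma hitting_set (T : finType) (F : {set {set T}}) (G : {set T}) (m : nat) :
  (0 < m)%N ->
  (forall A, A \in F -> A \subset G /\ (m <= #|A|)%N) ->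
  (forall A B, A \in F -> B \in F ->
     [\/ A \subset B, B \subset A | [disjoint A & B]]) ->
  exists H : {set T}, [/\ H \subset G, (#|H| * m <= #|G|)%N
    & forall A, A \in F -> ~~ [disjoint A & H]].
Proof.
move=> m_gt0; move: {2}(#|F|) (leqnn #|F|) => N.
elim: N F G => [|N IH] F G FN big lam.
  exists finset.set0; rewrite finset.sub0set cards0; split=> // A.
  by move: FN; rewrite leqn0 cards_eq0 => /eqP ->; rewrite inE.
have [->|/set0Pn[A0 A0F]] := eqVneq F finset.set0.
  by exists finset.set0; rewrite finset.sub0set cards0; split=> // A; rewrite inE.
case: (arg_minnP (fun A : {set T} => #|A|) A0F) => A AF' Amin; have AF : A \in F := AF'.
have [sAG mA] := big A AF.
have /card_gt0P[a aA] : (0 < #|A|)%N by exact: leq_trans m_gt0 mA.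
pose F' := [set B in F | [disjoint B & A]].
have AnF' : A \notin F'.
  rewrite inE AF /=; apply/negP => dAA.
  by have := disjointFr dAA aA; rewrite aA.
have F'N : (#|F'| <= N)%N.
  rewrite -ltnS; apply: leq_trans FN; apply/proper_card/properP; split; last by exists A.
  by apply/fintype.subsetP => B; rewrite inE => /andP[].
have [|B C|H [sH cH hitH]] := IH F' (G :\: A) F'N.
- move=> B; rewrite inE => /andP[/big[sBG mB] dBA]; split=> //.
  by rewrite finset.subsetD sBG.
- by rewrite !inE => /andP[BF _] /andP[CF _]; exact: lam.
exists (a |: H); split.
- rewrite finset.subUset finset.sub1set (fintype.subsetP sAG _ aA) /=.
  exact: fintype.subset_trans sH (finset.subsetDl _ _).
- apply: (@leq_trans (m + #|H| * m)%N).
    by rewrite -mulSn leq_mul2r cardsU1 -add1n leq_add2r leq_b1 orbT.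
  rewrite -(cardsID A G) (finset.setIidPr sAG); exact: leq_add.
move=> B BF; have [BF'|] := boolP (B \in F').
  have := hitH B BF'; apply: contra; apply: disjointWr.
  exact: finset.subsetUr.
rewrite inE BF /= => ndBA; apply/negP => dBH.
suff aB : a \in B by have := disjointFr dBH aB; rewrite !inE eqxx.
case: (lam _ _ AF BF) => [/fintype.subsetP/(_ a aA)//|sBA|dAB].
  suff -> : B = A by [].
  by apply/eqP; rewrite eqEcard sBA Amin.
by rewrite disjoint_sym dAB in ndBA.
Qed.

Section HaltProb.
Local Open Scope classical_set_scope.
Local Open Scope ring_scope.
Variables (n : nat) (R : realType) (d : 'I_n -> 'I_n -> R) (c : choices n R).
Variable Delta : nat.

Notation halt := (halt_prob d c Delta).
Notation succ := (successors d c Delta).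

Lemma haltS N st : halt N.+1 st =
  if queue st is [::] then 1 else
  (\sum_(st' <- succ st) halt N st') / (size (succ st))%:R.
Proof. by []. Qed.

Lemma halt_queue0 N st : queue st = [::] -> halt N st = 1.
Proof. by case: N => [|N] /= ->. Qed.

Lemma halt_ge0_le1 N st : 0 <= halt N st <= 1.
Proof.
elim: N st => [|N IH] st; first by rewrite /=; case: (queue st); rewrite ?lexx ?ler01.
rewrite haltS; case: (queue st) => [|_ _]; first by rewrite ler01 lexx.
apply/andP; split.
  by rewrite divr_ge0 // sumr_ge0 // => st' _; case/andP: (IH st').
have [->|s0] := eqVneq (size (succ st)) 0%N; first by rewrite invr0 mulr0.
rewrite ler_pdivrMr ?ltr0n ?lt0n // mul1r.
apply: (@le_trans _ _ (\sum_(st' <- succ st) 1)); last by rewrite big_const_seq count_predT iter_addr_0.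
by apply: ler_sum => st' _; case/andP: (IH st').
Qed.

Lemma halt_mono N st : halt N st <= halt N.+1 st.
Proof.
elim: N st => [|N IH] st.
  case qE : (queue st) => [|B Q]; first by rewrite !halt_queue0.
  by have /andP[h0 _] := halt_ge0_le1 1 st; rewrite /halt_prob qE in h0 *.
rewrite !haltS; case: (queue st) => [|_ _] //.
by rewrite ler_wpM2r ?invr_ge0 // ler_sum // => st' _; exact: IH.
Qed.

Definition halt_lim st : R := limn (fun N => halt N st).

Lemma halt_cvg st : halt N st @[N --> \oo] --> halt_lim st.
Proof.
apply: nondecreasing_is_cvgn; first by apply/nondecreasing_seqP => N; exact: halt_mono.
by exists 1 => _ [N _ <-]; case/andP: (halt_ge0_le1 N st).
Qed.

Lemma halt_lim_queue0 st : queue st = [::] -> halt_lim st = 1.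
Proof.
move=> qE; apply/cvg_lim => //.
by under eq_fun do rewrite halt_queue0 //; exact: cvg_cst.
Qed.

(** The recursive equation of [halt_prob], in the limit, with the empty list of
    successors, where it divides by zero, set apart. *)
Lemma halt_lim_mean st : queue st <> [::] ->
  halt_lim st * (size (succ st))%:R = \sum_(st' <- succ st) halt_lim st' \/ succ st = [::].
Proof.
move=> qn; have [s0|s0] := eqVneq (size (succ st)) 0%N; first by right; apply: size0nil.
left; have sn0 : (size (succ st))%:R != 0 :> R by rewrite pnatr_eq0.
apply: (mulIf (invr_neq0 sn0)); rewrite mulfK //.
have cvgS (s : seq (state n R)) :
    \sum_(st' <- s) halt N st' @[N --> \oo] --> \sum_(st' <- s) halt_lim st'.
  elim: s => [|x s IH].
    by under eq_fun do rewrite big_nil; rewrite big_nil; exact: cvg_cst.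
  by under eq_fun do rewrite big_cons; rewrite big_cons; apply: cvgD => //; exact: halt_cvg.
have c1 : halt N.+1 st @[N --> \oo] --> halt_lim st.
  by have := @halt_cvg st; rewrite -(cvg_shiftS (fun N => halt N st)).
have c2 : halt N.+1 st @[N --> \oo]
    --> (\sum_(st' <- succ st) halt_lim st') / (size (succ st))%:R.
  under eq_fun do rewrite haltS.
  by case: (queue st) qn => // _ _ _; apply: cvgM (cvg_cst _).
exact: (cvg_unique _ c1 c2).
Qed.

End HaltProb.

(** * Almost sure termination *)

Section Termination.
Variables (R : realType) (V : finType) (e : rel V) (n : nat) (lab : 'I_n -> V).
Variable len : V -> V -> R.
Hypothesis treeT : is_tree e.
Hypothesis deg_lab : forall v, (degree e v <= 2)%N -> exists i, lab i = v.
Hypothesis len_sym : forall u v, len u v = len v u.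
Hypothesis len_gt0 : forall u v, e u v -> 0 < len u v.
Variables (d : 'I_n -> 'I_n -> R) (c : choices n R).
Hypothesis dE : forall i j, d i j = tdist len treeT (lab i) (lab j).

Notation btw := (btw treeT).
Notation bag := (bag n R).
Notation state := (state n R).
Notation resolution := (resolution lab len treeT).
Notation encodes := (encodes lab len treeT).
Notation covers := (covers lab len treeT).
Notation names_labels := (names_labels lab).
Notation is_branch := (is_branch lab treeT).
Notation partial_run := (partial_run lab len treeT c).
Notation Delta := (max_degree e).

(** Two vertices on the way from [r] to a common label are comparable. *)
Lemma is_branch_laminar r (A B : {set 'I_n}) : is_branch r A -> is_branch r B ->
  [\/ A \subset B, B \subset A | [disjoint A & B]].
Proof.
move=> /existsP[x /eqP ->] /existsP[y /eqP ->].
set A' := [set i | btw r x (lab i)]; set B' := [set i | btw r y (lab i)].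
have [dAB|] := boolP [disjoint A' & B']; first by constructor 3.
rewrite finset.disjoints_subset => /subsetPn[i]; rewrite !inE negbK => rxi ryi.
case: (btw_total rxi ryi) => [rxy|ryx]; [constructor 2|constructor 1];
  apply/fintype.subsetP => j; rewrite !inE; exact: btw_trans.
Qed.

(** With [s = sqrt D], if [h > D] then [(s ^ 2 + 1) * m <= N], whereas heaviness
    says [N + 1 < (m + 1) * s]; and [(m + 1) * s <= 2 * m * s <= m * (s ^ 2 + 1)]. *)
Lemma hitting_number_le (m h N D : nat) : (0 < m)%N -> (0 < D)%N -> (h * m <= N)%N ->
  (N.+1%:R / Num.sqrt D%:R : R) < m.+1%:R -> (h <= D)%N.
Proof.
move=> m0 D0 hN heavy; rewrite leqNgt; apply/negP => Dh.
have : (D.+1 * m <= N)%N by apply: leq_trans hN; rewrite leq_mul2r Dh orbT.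
rewrite -(ler_nat R) natrM -addn1 natrD => DN.
have m1 : (1 : R) <= m%:R by rewrite ler1n.
have s0 : 0 < Num.sqrt (D%:R : R) by rewrite sqrtr_gt0 ltr0n.
have sD : Num.sqrt (D%:R : R) ^+ 2 = D%:R by rewrite sqr_sqrtr // ler0n.
move: heavy; rewrite ltr_pdivrMr // -[N.+1]addn1 -[m.+1]addn1 !natrD.
move: DN m1 s0 sD; set s := Num.sqrt _; move: (D%:R) (m%:R) (N%:R) => D' m' N'.
move=> DN m1 s0 sD; apply/negP; rewrite -leNgt.
have : 0 <= m' * (s - 1) ^+ 2 by rewrite mulr_ge0 ?sqr_ge0 //; lra.
have : 0 <= (m' - 1) * s by rewrite mulr_ge0 //; lra.
rewrite -sD in DN; nra.
Qed.

Lemma pad_sample (H G : {set 'I_n}) D : H \subset G -> (#|H| <= D <= #|G|)%N ->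
  exists us : D.-tuple 'I_n,
    [/\ uniq us, {subset us <= G} & {subset H <= us}].
Proof.
move=> sHG /andP[HD DG]; pose s := enum H ++ take (D - #|H|) (enum (G :\: H)).
have sz : size s == D.
  rewrite size_cat size_takel -!cardE ?subnKC //.
  rewrite leq_subLR; apply: leq_trans DG _.
  by rewrite -(cardsID H G) (finset.setIidPr sHG).
exists (Tuple sz); split => /=.
- rewrite cat_uniq enum_uniq take_uniq ?enum_uniq // andbT.
  by apply/hasPn => i /mem_take; rewrite !mem_enum inE => /andP[].
- move=> i; rewrite mem_cat => /orP[|/mem_take]; rewrite mem_enum.
    exact: fintype.subsetP.
  by rewrite inE => /andP[].
- by move=> i iH; rewrite mem_cat mem_enum iH.
Qed.

Lemma max_bsize_le (C : seq bag) (x : R) : 0 <= x ->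
  all (fun b => (bsize b)%:R <= x) C -> (\max_(b <- C) bsize b)%N%:R <= x.
Proof.
move=> x0; elim: C => [|b C IH] /=; first by rewrite big_nil.
by case/andP=> bx /IH Cx; rewrite big_cons; case: (leqP (bsize b)).
Qed.

Lemma max_degree0 w (U : {set V}) : region e w U -> Delta = 0%N -> U = finset.set0.
Proof.
case=> wU _ D0; apply/eqP/contraT => /set0Pn[u uU].
have uw : u != w by apply: contraNneq wU => <-.
have [x eux _] := first_step treeT uw.
have : (0 < degree e u)%N by apply/card_gt0P; exists x; rewrite inE.
by rewrite ltnNge -D0 (leq_bigmax u).
Qed.

Section OnePass.
Variables (phi : V -> node n) (B : bag) (w : V) (U : {set V}) (k : nat).
Hypotheses (nm : names_labels phi) (enc : encodes phi B w U).
Hypothesis old : forall j, phi w = inr j -> (j < k)%N.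

Lemma mem_samples us : (us \in samples Delta B) =
  uniq us && all (fun i => i \in bothers B) us.
Proof. by rewrite mem_enum. Qed.

(** Call a branch heavy if the bag on it would be too large. The heavy branches
    form a laminar family, so a set of at most [Delta] labels meets all of them.
    A sample that contains these labels is accepted, because no label of a bag
    in the output has been sampled. *)
Lemma ex_accepted_sample : (Delta < bsize B)%N ->
  exists2 us, us \in samples Delta B &
    accepted Delta B (split_pass d c k B us).1.1.
Proof.
move=> bigB; have [regU _ bE _] := enc.
set x : R := (bsize B)%:R / Num.sqrt Delta%:R.
have x0 : 0 <= x by rewrite divr_ge0 ?ler0n ?sqrtr_ge0.
pose F := [set A : {set 'I_n} |
  [&& A != finset.set0, A \subset bothers B, is_branch w A & x < #|A|.+1%:R]].
have [H [sHB HD hitF]] : exists H : {set 'I_n}, [/\ H \subset bothers B,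
    (#|H| <= Delta)%N & forall A, A \in F -> ~~ [disjoint A & H]].
  have [->|/set0Pn[A0 A0F]] := eqVneq F finset.set0.
    by exists finset.set0; rewrite finset.sub0set cards0; split=> // A; rewrite inE.
  (* A heavy branch of least size: its size serves as [m] in [hitting_set]. *)
  case: (arg_minnP (fun A : {set 'I_n} => #|A|) A0F) => A AF' Amin.
  have : A \in F := AF'; rewrite inE => /and4P[An0 AB _ Aheavy].
  have m0 : (0 < #|A|)%N by rewrite card_gt0.
  have D0 : (0 < Delta)%N.
    rewrite lt0n; apply: contraNneq An0 => /(max_degree0 regU) U0.
    rewrite -finset.subset0; apply: fintype.subset_trans AB _.
    by apply/fintype.subsetP => i; rewrite bE U0 !inE.
  have [A1|A1 A2|H [sH cH hitH]] := hitting_set (F := F) (G := bothers B) m0.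
  - move=> A1F; move: (A1F); rewrite inE => /and4P[_ -> _ _]; split=> //.
    exact: Amin.
  - by rewrite !inE => /and4P[_ _ br1 _] /and4P[_ _ br2 _]; exact: is_branch_laminar br1 br2.
  exists H; split=> //; exact: hitting_number_le m0 D0 cH Aheavy.
have [us [us_uniq usB Hus]] : exists us : Delta.-tuple 'I_n,
    [/\ uniq us, {subset us <= bothers B} & {subset H <= us}].
  by apply: pad_sample; rewrite // HD.
exists us; first by rewrite mem_samples us_uniq; apply/allP.
case passE : (split_pass d c k B us) => [[C E] k'].
have [phi' [U' [res usU' brC]]] :=
  split_pass_resolution deg_lab len_sym len_gt0 dE nm enc old passE.
apply: max_bsize_le => //=.
have light b : (bothers b != finset.set0) && is_branch w (bothers b) ->
    bothers b \subset labels_in lab U' -> (bsize b)%:R <= x.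
  case/andP=> bn0 br bU'; rewrite leNgt; apply/negP => heavy.
  have /hitF : bothers b \in F.
    rewrite inE bn0 br /= -/(bsize b) heavy andbT.
    apply: fintype.subset_trans bU' _; rewrite bE.
    apply/fintype.subsetP => i; rewrite !inE.
    exact: (fintype.subsetP (res_sub res)).
  rewrite finset.disjoints_subset => /subsetPn[i ib]; rewrite inE negbK => /Hus/usU'.
  by move: (fintype.subsetP bU' _ ib); rewrite inE => ->.
elim: (C) brC (covers_sub (res_covers res)) => //= b C' IHC /andP[p1 p2] /andP[q1 q2].
by rewrite light // IHC.
Qed.

(** The new bags are nonempty and disjoint and avoid the sampled nodes. *)
Lemma pass_weight us C E k' : us \in samples Delta B ->
  split_pass d c k B us = (C, E, k') ->
  (\sum_(b <- C) maxn 1 #|bothers b| < maxn 1 #|bothers B|)%N.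
Proof.
move=> usB passE.
have [phi' [U' [res usU' brC]]] :=
  split_pass_resolution deg_lab len_sym len_gt0 dE nm enc old passE.
have -> : (\sum_(b <- C) maxn 1 #|bothers b| = \sum_(b <- C) #|bothers b|)%N.
  elim: C brC {passE res} => [|b C IH] /=; first by rewrite !big_nil.
  case/andP=> /andP[bn0 _] /IH IHE; rewrite !big_cons IHE.
  by rewrite (maxn_idPr _) // card_gt0.
rewrite (covers_card (res_covers res)).
have [regU _ bE _] := enc; have sU := res_sub res.
have sL : labels_in lab U' \subset bothers B.
  by rewrite bE; apply/fintype.subsetP => i; rewrite !inE; apply: fintype.subsetP.
case: us usB usU' {passE} => -[|u us] /= sz; rewrite mem_samples /=.
  move=> _ _; rewrite (_ : labels_in lab U' = finset.set0) ?cards0 ?leq_max //.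
  have U0 := max_degree0 regU (esym (eqP sz)).
  apply/setP => i; rewrite finset.in_set0; apply/negP => /(fintype.subsetP sL).
  by rewrite bE U0 !inE.
case/and3P=> _ uB _ /(_ u (mem_head _ _)) uU'.
apply: leq_trans (leq_maxr _ _); apply/proper_card/properP; split=> //.
by exists u; rewrite // inE.
Qed.
End OnePass.

(** Counting an empty bag as 1 makes the weight drop also when the tree has a
    single vertex and the initial bag is empty. *)
Definition weight (st : state) : nat := (\sum_(b <- queue st) maxn 1 #|bothers b|)%N.

Lemma halt_lim_le1 st : halt_lim d c Delta st <= 1.
Proof.
apply: limr_le; first by apply/cvg_ex; exists (halt_lim d c Delta st); exact: halt_cvg.
by apply: nearW => N; case/andP: (halt_ge0_le1 d c Delta N st).
Qed.

(** Induction on the weight. Rejected samples lead back to the same state and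
    accepted ones to a smaller weight, where the limit is 1. So the limit is the
    mean of copies of itself and of 1, with at least one copy of 1. *)
Lemma halt_lim1 st phi (U : {set V}) : partial_run st phi U -> halt_lim d c Delta st = 1.
Proof.
have [m] := ubnP (weight st); elim: m st phi U => // m IH st phi U /ltnSE wst run.
case qE : (queue st) => [|B Q]; first exact: halt_lim_queue0.
have qn : queue st <> [::] by rewrite qE.
have decr st' phi' (U' : {set V}) : partial_run st' phi' U' ->
    (weight st' < weight st)%N -> halt_lim d c Delta st' = 1.
  by move=> run' lt'; apply: IH run'; apply: leq_trans wst.
have wE : weight st = (maxn 1 #|bothers B| + \sum_(b <- Q) maxn 1 #|bothers b|)%N.
  by rewrite /weight qE big_cons.
have [bB|bB] := leqP (bsize B) Delta.
  have sE : successors d c Delta st = [:: small_step d c B Q st].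
    by rewrite /successors qE bB.
  case: (halt_lim_mean d c Delta qn); rewrite sE // big_seq1 mulr1 => ->.
  have [phi' [U' run']] := partial_run_small deg_lab len_sym len_gt0 dE qE run.
  apply: decr run' _; rewrite wE /weight /small_step.
  by case: (ch_solve _ _ _ _) => F k' /=; rewrite -[X in (X < _)%N]add0n ltn_add2r leq_max.
have sE : successors d c Delta st = [seq big_step d c Delta B Q st us | us : Delta.-tuple 'I_n <- samples Delta B].
  by rewrite /successors qE leqNgt bB.
move: (run); rewrite /partial_run qE => res.
have [w' [U' [enc sU' w'U old glue]]] := resolution_comp res.
have nm := res_names res.
set x := halt_lim d c Delta st.
have stepE (us : Delta.-tuple 'I_n) : us \in samples Delta B ->
    halt_lim d c Delta (big_step d c Delta B Q st us) =
    if accepted Delta B (split_pass d c (fresh st) B us).1.1 then 1 else x.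
  move=> usB; rewrite /big_step.
  case passE : (split_pass _ _ _ _ _) => [[C E] k'] /=; case: ifP => // _.
  have [phi' [U'' run']] := partial_run_big deg_lab len_sym len_gt0 dE qE run passE.
  apply: decr run' _; rewrite wE /weight /= big_cat /= addnC ltn_add2r.
  exact: (pass_weight nm enc old usB passE).
have [us usB usacc] := ex_accepted_sample nm enc old bB.
have sum0 : \sum_(us <- samples Delta B)
    (halt_lim d c Delta (big_step d c Delta B Q st us) - x) == 0.
  case: (halt_lim_mean d c Delta qn); rewrite sE; last first.
    by move/(congr1 size); rewrite size_map; case: (samples _ _) usB.
  rewrite big_map size_map -/x => mean.
  by rewrite big_split /= sumrN -mean big_const_seq count_predT iter_addr_0 mulr_natr subrr.
move: sum0; rewrite big_seq psumr_eq0 => [|us' us'B].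
  move=> /allP/(_ us usB); rewrite usB stepE // usacc /= subr_eq0.
  by move=> /eqP.
by rewrite stepE //; case: ifP => _; rewrite ?subrr // subr_ge0 halt_lim_le1.
Qed.

End Termination.

(** * Correlations as edge lengths *)

Section CorrelationMetric.
Variables (V : finType) (e : rel V) (R : realType) (r : V -> V -> R).
Hypothesis r_edge : forall u v, e u v -> 0 < `|r u v| < 1.

Definition log_len u v : R := - ln `|r u v|.

Lemma log_len_gt0 u v : e u v -> 0 < log_len u v.
Proof. by move=> /r_edge r01; rewrite oppr_gt0 ln_lt0. Qed.

(** The logarithm turns the path product into the length of the path. *)
Lemma log_path_product u p : path e u p ->
  0 < `|\prod_(uv <- path_edges u p) r uv.1 uv.2| /\
  - ln `|\prod_(uv <- path_edges u p) r uv.1 uv.2| = plen log_len u p.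
Proof.
elim: p u => [|x p IH] u /=; first by rewrite big_nil normr1 ltr01 ln1 oppr0 plen_nil.
case/andP=> /r_edge/andP[rux _] /IH[prod_gt0 prodE].
rewrite [path_edges _ _]/= big_cons normrM mulr_gt0 //; split=> //.
by rewrite lnM ?posrE // opprD plen_cons -prodE.
Qed.

End CorrelationMetric.

Local Open Scope classical_set_scope.
Theorem proposition5p1
  (R : realType) (V : finType) (e : rel V) (n : nat) (lab : 'I_n -> V)
  (disp : measure_display) (Omega : measurableType disp)
  (P : probability Omega R) (Y : V -> {RV P >-> R})
  (hT : semi_labeled_tree e lab)
  (hY : latent_tree_model e Y)
  (hedge : forall u v, e u v -> 0 < `|correlation (Y u) (Y v)| < 1)
  (hpath : forall (i j : 'I_n) (p : seq V), simple_path e (lab i) (lab j) p ->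
     correlation (Y (lab i)) (Y (lab j))
       = \prod_(uv <- path_edges (lab i) p) correlation (Y uv.1) (Y uv.2))
  (c : choices n R) :
  let Delta := max_degree e in
  let d := log_oracle
             (fun i j => correlation (Y (lab i)) (Y (lab j))) in
  (forall S, tree_returns d c Delta S -> recovers e lab S) /\
  (halt_prob d c Delta N (tree_init c) @[N --> \oo] --> (1 : R)).
Proof.
move=> Delta d; have [treeT lab_inj deg_lab] := hT.
pose r u v := correlation (Y u) (Y v).
have rC u v : r u v = r v u by rewrite /r /correlation covarianceC [X in _ / X]mulrC.
have len_sym u v : log_len r u v = log_len r v u by rewrite /log_len rC.
have len_gt0 u v : e u v -> 0 < log_len r u v by exact: log_len_gt0.
have dE i j : d i j = tdist (log_len r) treeT (lab i) (lab j).
  rewrite /d /log_oracle; case: eqVneq => [->|_]; first by rewrite tdistxx.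
  rewrite (hpath _ _ _ (spathP treeT (lab i) (lab j))).
  by have [_ ->] := log_path_product hedge (path_spath treeT (lab i) (lab j)).
split=> [S|].
  exact: (tree_returns_recovers lab_inj deg_lab len_sym len_gt0 dE).
have run := partial_run_init (log_len r) treeT lab_inj c.
rewrite -(halt_lim1 deg_lab len_sym len_gt0 dE run).
exact: halt_cvg.
Qed.
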